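(* Consider Gaussian nonparametric regression: for each $n$ one observes $Y^{(n)}=(Y_1,\dots,Y_n)$ with $Y_i$ independent $N(f(x_i),1)$ for fixed inputs $x_i\in[0,1]^d$, and likelihood $q_n(f,Y^{(n)})=\prod_{i=1}^n\phi(Y_i-f(x_i))$ ($\phi$ the standard normal density); write $P^{(n)}_f$ for this distribution. Let $\mathcal{F}^\star$ be a set of measurable functions $[0,1]^d\to\mathbb{R}$. For each $n$ let $\mathcal{M}_n\subset\mathbb{N}_{\ge2}\times\mathbb{N}$ be a set of depth-width pairs with $|\mathcal{M}_n|\lesssim n^\iota$ for some constant $\iota>0$ and $\max_{(K,M)\in\mathcal{M}_n}(K\vee M)\lesssim n$, and let $1\le B_n\lesssim n^\nu$ for some $\nu>0$. Then the adaptive variational posterior $\widehat\Xi_n$ over neural networks defined below satisfies, for any sequence $A_n\to\infty$, $$\sup_{f^\star\in\mathcal{F}^\star}P^{(n)}_{f^\star}\Big[\widehat\Xi_n\big(\|\mathrm{net}(\theta)-f^\star\|_{n,2}\ge A_n\epsilon_n(\mathcal{F}^\star)\big)\Big]\to0,$$ where $$\epsilon_n(\mathcal{F}^\star):=\inf_{(K,M)\in\mathcal{M}_n}\Big\{\sup_{f^*\in\mathcal{F}^\star}\inf_{\theta\in\Theta^{\le B_n}_{(K,M)}}\|\mathrm{net}(\theta)-f^*\|_\infty+KM\sqrt{\tfrac{\log n}{n}}\Big\}.$$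
   Context: Neural networks: for $K\ge2$, $M\ge1$, $\Theta_{(K,M)}$ is the set of tuples $\theta=((W_k,b_k))_{k\in[K]}$ with $W_k\in\mathbb{R}^{M_{k+1}\times M_k}$, $b_k\in\mathbb{R}^{M_{k+1}}$, where $M_1=d$, $M_2=\dots=M_K=M$, $M_{K+1}=1$; $p_{(K,M)}$ is its dimension; $\mathrm{net}(\theta)(x)=[W_K,b_K]\circ\mathrm{ReLU}\circ[W_{K-1},b_{K-1}]\circ\cdots\circ\mathrm{ReLU}\circ[W_1,b_1]x$ with $[W,b]x=Wx+b$ and elementwise $\mathrm{ReLU}(x)=\max(x,0)$. $\Theta^{\le B}_{(K,M)}=\{\theta\in\Theta_{(K,M)}:|\theta|_\infty\le B\}$ (max absolute entry). Prior: $\Pi_n=\sum_{(K,M)\in\mathcal{M}_n}\alpha_{n,(K,M)}\Pi_{n,(K,M)}$, $\Pi_{n,(K,M)}=\bigotimes_{j=1}^{p_{(K,M)}}\mathrm{Unif}(-B_n,B_n)$ on $\Theta^{\le B_n}_{(K,M)}$, $\alpha_{n,(K,M)}\propto e^{-b_0(KM)^2\log n}$ for a fixed $b_0>0$. Variational family for each $(K,M)$: $\mathbb{V}_{n,(K,M)}=\{\bigotimes_{j=1}^{p_{(K,M)}}\mathrm{Unif}(\psi_{1,j},\psi_{2,j}):-B_n\le\psi_{1,j}<\psi_{2,j}\le B_n\}$. Variational posterior: $\widehat\Xi_n=\sum_{(K,M)}\widehat\gamma_{n,(K,M)}\widehat\Xi_{n,(K,M)}$ with $\widehat\Xi_{n,(K,M)}\in\operatorname{argmin}_{\Xi\in\mathbb{V}_{n,(K,M)}}\mathcal{E}(\Xi,\Pi_{n,(K,M)})$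 and $\widehat\gamma_{n,(K,M)}\propto\alpha_{n,(K,M)}e^{-\mathcal{E}(\widehat\Xi_{n,(K,M)},\Pi_{n,(K,M)})}$, where $\mathcal{E}(\Xi,\Pi)=-\int\log q_n(\mathrm{net}(\theta),Y^{(n)})d\Xi(\theta)+\mathrm{KL}(\Xi,\Pi)$. Empirical norm: $\|g\|_{n,2}=(\frac1n\sum_{i=1}^ng(x_i)^2)^{1/2}$; $\|g\|_\infty=\sup_{x\in[0,1]^d}|g(x)|$. *)

(* Defs.v *)
From HB Require Import structures.
From mathcomp Require Import all_boot all_order all_algebra.
From mathcomp Require Import all_classical all_reals all_analysis.
From mathcomp Require Import normal_distribution.
Unset Printing Implicit Defensive.
Import Order.TTheory GRing.Theory Num.Theory.
Import numFieldNormedType.Exports.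
Local Open Scope classical_set_scope.
Local Open Scope ring_scope.

Section Defs.
Context {R : realType}.

Definition cube (d : nat) : set 'rV[R]_d := [set x | forall j, 0 <= x 0 j <= 1].

Definition borel_measurable_cube (d : nat) (f : 'rV[R]_d -> R) : Prop :=
  forall U : set R, open U ->
    (<<s [set: 'rV[R]_d], [set A : set 'rV[R]_d | open A] >>) (cube d `&` f @^-1` U).

(* A parameter theta of the architecture (K,M) is stored as a flat vector
   theta : nat -> R, of which only the first npar d K M entries are used.
   Layout: layer 1 : W_1 (M x d, row-major) then b_1 (M);
   hidden layer t+2 (t = 0 .. K-3) at offset hoff d M t : W (M x M) then b (M);
   output layer K at offset hoff d M (K-2) : W_K (1 x M) then b_K (1). *)
Definition relu (x : R) : R := Num.max x 0.

Definition hoff (d M t : nat) : nat := (M * d + M + t * (M * M + M))%N.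

Definition npar (d K M : nat) : nat := (hoff d M (K - 2) + M + 1)%N.

(* output of the hidden layer number t+1 (after ReLU), coordinates i < M *)
Fixpoint hid (d M : nat) (theta : nat -> R) (x : 'rV[R]_d) (t : nat) : nat -> R :=
  match t with
  | 0 => fun i => relu (\sum_(j < d) theta (i * d + j)%N * x 0 j + theta (M * d + i)%N)
  | t'.+1 => fun i => relu (\sum_(j < M) theta (hoff d M t' + i * M + j)%N * hid d M theta x t' j
                           + theta (hoff d M t' + M * M + i)%N)
  end.

Definition net (d K M : nat) (theta : nat -> R) (x : 'rV[R]_d) : R :=
  \sum_(j < M) theta (hoff d M (K - 2) + j)%N * hid d M theta x (K - 2) j
  + theta (hoff d M (K - 2) + M)%N.

Definition bounded_par (d K M : nat) (B : R) (theta : nat -> R) : Prop :=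
  forall j, (j < npar d K M)%N -> `|theta j| <= B.

Definition supnorm (d : nat) (g : 'rV[R]_d -> R) : \bar R :=
  ereal_sup [set (`|g x|)%:E | x in cube d].

(* design: X n i is the i-th input when the sample size is n *)
Definition empnorm (d : nat) (X : nat -> nat -> 'rV[R]_d) (n : nat) (g : 'rV[R]_d -> R) : R :=
  Num.sqrt (n%:R^-1 * \sum_(i < n) (g (X n i)) ^+ 2).

(* iint k D g = int_{D (k-1)} ... int_{D 0} g(t_0,...,t_{k-1}) dt_0 ... dt_{k-1}
   (coordinates >= k are set to 0): integral of g w.r.t. Lebesgue measure on
   D 0 x ... x D (k-1), computed as an iterated integral. *)
Definition upd (theta : nat -> R) (k : nat) (t : R) : nat -> R :=
  fun j => if j == k then t else theta j.

Fixpoint iint (k : nat) (D : nat -> set R) (g : (nat -> R) -> \bar R) : \bar R :=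
  match k with
  | 0 => g (fun _ => 0)
  | k'.+1 => (\int[@lebesgue_measure R]_(t in D k')
                 iint k' D (fun theta => g (upd theta k' t)))%E
  end.

Definition phi (y : R) : R := normal_pdf 0 1 y.

Definition lik (d : nat) (X : nat -> nat -> 'rV[R]_d) (n : nat) (f : 'rV[R]_d -> R)
  (Y : nat -> R) : R := \prod_(i < n) phi (Y i - f (X n i)).

Definition Egauss (d : nat) (X : nat -> nat -> 'rV[R]_d) (n : nat) (f : 'rV[R]_d -> R)
  (G : (nat -> R) -> \bar R) : \bar R :=
  iint n (fun _ => [set: R]) (fun Y => (G Y * (lik d X n f Y)%:E)%E).

(* psi = (psi1, psi2): the distribution (x)_{j < p} Unif(psi1 j, psi2 j) *)
Definition box (psi : (nat -> R) * (nat -> R)) : nat -> set R :=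
  fun j => `[psi.1 j, psi.2 j]%classic.

Definition boxvol (p : nat) (psi : (nat -> R) * (nat -> R)) : R :=
  \prod_(j < p) (psi.2 j - psi.1 j).

Definition Ebox (p : nat) (psi : (nat -> R) * (nat -> R)) (G : (nat -> R) -> \bar R) : \bar R :=
  (iint p (box psi) G * ((boxvol p psi)^-1)%:E)%E.

Definition valid_box (p : nat) (B : R) (psi : (nat -> R) * (nat -> R)) : Prop :=
  forall j, (j < p)%N -> - B <= psi.1 j /\ psi.1 j < psi.2 j /\ psi.2 j <= B.

(* KL(Xi, Pi) = int log (dXi/dPi) dXi, where Xi = Unif(box psi) has density
   1/boxvol and Pi = Unif([-B,B]^p) has density 1/(2B)^p on the box. *)
Definition KLbox (p : nat) (B : R) (psi : (nat -> R) * (nat -> R)) : \bar R :=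
  Ebox p psi (fun _ => (ln ((boxvol p psi)^-1 / ((B *+ 2) ^+ p)^-1))%:E).

Definition ELBOobj (d : nat) (X : nat -> nat -> 'rV[R]_d) (n K M : nat) (B : R)
  (Y : nat -> R) (psi : (nat -> R) * (nat -> R)) : \bar R :=
  (- Ebox (npar d K M) psi (fun theta => (ln (lik d X n (net d K M theta) Y))%:E)
   + KLbox (npar d K M) B psi)%E.

(* prior model weight alpha_{n,(K,M)} up to normalisation *)
Definition alpha (b0 : R) (n K M : nat) : R :=
  expR (- b0 * ((K * M)%:R ^+ 2) * ln n%:R).

Definition rate (d : nat) (Fs : set ('rV[R]_d -> R)) (Ms : seq (nat * nat)) (B : R) (n : nat)
  : \bar R :=
  ereal_inf [set (ereal_sup [set ereal_inf
                       [set supnorm d (fun x => (net d KM.1 KM.2 theta x - f x)%R)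
                          | theta in bounded_par d KM.1 KM.2 B] | f in Fs]
                  + ((KM.1 * KM.2)%:R * Num.sqrt (ln n%:R / n%:R))%:E)%E
             | KM in [set KM | KM \in Ms]].

Definition bad_event (d : nat) (X : nat -> nat -> 'rV[R]_d) (n K M : nat) (f : 'rV[R]_d -> R)
  (thr : \bar R) : set (nat -> R) :=
  [set theta | (thr <= (empnorm d X n (fun x => (net d K M theta x - f x)%R))%:E)%E].

(* the adaptive variational posterior mass of the event, given the data Y:
   sum_{(K,M)} gamma_{n,(K,M)} Xi_{n,(K,M)}(event), with
   gamma_{n,(K,M)} proportional to alpha_{n,(K,M)} exp(- E(Xi_{n,(K,M)}, Pi_{n,(K,M)})),
   where Xi_{n,(K,M)} = Unif(box psihat (K,M)). The normalising sum is finite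
   and positive (the objective is finite), so it is taken as a real via fine. *)
Definition vpost (d : nat) (X : nat -> nat -> 'rV[R]_d) (b0 : R) (Ms : seq (nat * nat))
  (B : R) (n : nat) (psihat : nat * nat -> (nat -> R) * (nat -> R)) (Y : nat -> R)
  (f : 'rV[R]_d -> R) (thr : \bar R) : \bar R :=
  let w KM := ((alpha b0 n KM.1 KM.2)%:E
               * expeR (- ELBOobj d X n KM.1 KM.2 B Y (psihat KM)))%E in
  ((\sum_(KM <- Ms) w KM * Ebox (npar d KM.1 KM.2) (psihat KM)
                              (fun theta => (\1_(bad_event d X n KM.1 KM.2 f thr) theta)%:E))
   * ((fine (\sum_(KM <- Ms) w KM))^-1)%:E)%E.

End Defs.

(* Main.v *)
Require Import Defs.
From HB Require Import structures.
From mathcomp Require Import all_boot all_order all_algebra.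
From mathcomp Require Import all_classical all_reals all_analysis.
From mathcomp Require Import measurable_realfun normal_distribution zify ring lra.
Import Order.TTheory GRing.Theory Num.Theory.
Import numFieldNormedType.Exports.
Local Open Scope classical_set_scope.
Local Open Scope ring_scope.

(* Write Z_i = Y_i - f0(x_i), g = (net theta - f0)(x_i)_i, <.,.> and |.| for the Euclidean
   structure on R^n, so that the likelihood ratio against f0 is exp(<Z,g> - |g|^2/2).  Let m0 be
   an almost optimal architecture, rho the rate, N = n rho^2 >= log n, and (K M)^2 log n the
   complexity of an architecture.
   Lower bound: testing the variational problem of m0 with the uniform law on a tiny cell around
   a good parameter gives, relative to the likelihood of f0, a weight of m0 of at least
   exp(- c N), with high probability.
   Large architectures (complexity >= H N): by Jensen their weight is at most the prior weight
   times the prior mean of the likelihood ratio, whose expectation is 1; the prior weight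
   exp(- b0 H N) wins.
   Small architectures: each tilt exp(<Z,g>/4 - |g|^2/32) has expectation 1, and averaging it over
   cells bounds <Z,g> - |g|^2/4 by c H N on the whole parameter cube.  Hence a fitted box giving
   mass xi > eta to the bad event loses a factor exp(- eta A_n^2 N / 4).
   Every exceptional event is handled by adding to the upper bound a nonnegative functional that
   is >= 1 on it, so that only expectations of exponentials of linear forms in Z are needed.
   Since psihat is not assumed measurable in Y, this also reduces the claim to measurable
   majorants, for which the iterated integrals are monotone. *)

(** * Iterated integrals *)

Section IteratedIntegral.
Context {R : realType}.
Local Notation mu := (@lebesgue_measure R).

Definition meas_coord {d} {T : measurableType d} (u : T -> nat -> R) : Prop :=
  forall j, measurable_fun [set: T] (fun t => u t j).

(* [nat -> R] carries no sigma-algebra in the definitions: a family of functionals on it is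
   called measurable when every substitution of measurable coordinates is.  This class is
   stable under partial integration, so that Tonelli can be iterated. *)
Definition jmeas {d} {T : measurableType d} (H : T -> (nat -> R) -> \bar R) : Prop :=
  forall d' (T' : measurableType d') (v : T' -> T) (u : T' -> nat -> R),
    measurable_fun [set: T'] v -> meas_coord u ->
    measurable_fun [set: T'] (fun t => H (v t) (u t)).

Definition cmeas (G : (nat -> R) -> \bar R) : Prop := jmeas (fun _ : unit => G).

Lemma cmeasP (G : (nat -> R) -> \bar R) : cmeas G <->
  (forall d' (T' : measurableType d') (u : T' -> nat -> R), meas_coord u ->
    measurable_fun [set: T'] (fun t => G (u t))).
Proof.
split=> [H d' T' u mu_|H d' T' v u _ mu_]; last exact: H.
exact: (H d' T' (fun=> tt) u (measurable_cst _) mu_).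
Qed.

Definition jmeas2 (F : (nat -> R) -> (nat -> R) -> \bar R) : Prop :=
  forall d' (T' : measurableType d') (v u : T' -> nat -> R),
    meas_coord v -> meas_coord u ->
    measurable_fun [set: T'] (fun t => F (v t) (u t)).

Lemma meas_coord_upd {d} {T : measurableType d} (u : T -> nat -> R) k (s : T -> R) :
  meas_coord u -> measurable_fun [set: T] s -> meas_coord (fun t => upd (u t) k (s t)).
Proof. by move=> mu_ ms j; rewrite /upd; case: (j == k). Qed.

Lemma jmeas_upd {d} {T : measurableType d} (H : T -> (nat -> R) -> \bar R) k :
  jmeas H ->
  jmeas (fun (ts : T * measurableTypeR R) theta => H ts.1 (upd theta k ts.2)).
Proof.
move=> mH d' T' v u mv mu_; apply: mH; first exact: measurableT_comp.
by apply: meas_coord_upd => //; exact: measurableT_comp.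
Qed.

Lemma cmeas_upd (G : (nat -> R) -> \bar R) k (s : R) :
  cmeas G -> cmeas (fun theta => G (upd theta k s)).
Proof.
move=> mG d' T' v u mv mu_; apply: (mG _ _ v) => //.
by apply: meas_coord_upd => //; exact: measurable_cst.
Qed.

Lemma cmeas_updv (G : (nat -> R) -> \bar R) k : cmeas G ->
  jmeas (fun (s : measurableTypeR R) theta => G (upd theta k s)).
Proof.
move=> mG d' T' v u mv mu_; apply: (mG _ _ (fun=> tt)) => //.
exact: meas_coord_upd.
Qed.

Lemma iint_ge0 k D (G : (nat -> R) -> \bar R) :
  (forall theta, 0 <= G theta)%E -> (0 <= iint k D G)%E.
Proof. by elim: k G => [|k IH] G G0 //=; apply: integral_ge0 => t _; apply: IH. Qed.

(** The integral of a nonnegative function is a supremum over the simple functions below it, so the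
    comparison stays valid for functions that may fail to be measurable, such as the posterior mass
    as a function of [Y]. *)
Lemma integral_mono (D : set (measurableTypeR R)) (f g : measurableTypeR R -> \bar R) :
  (forall x, D x -> 0 <= f x)%E -> (forall x, D x -> f x <= g x)%E ->
  (\int[mu]_(x in D) f x <= \int[mu]_(x in D) g x)%E.
Proof.
move=> f0 fg; have g0 x : D x -> (0 <= g x)%E by move=> Dx; apply: le_trans (fg x Dx); exact: f0.
rewrite !ge0_integralE//; apply: ereal_sup_le => _ [h /= hf <-].
exists h => // x; apply: (le_trans (hf x)); rewrite /patch; case: ifPn => //.
by rewrite inE => Dx; exact: fg.
Qed.

Lemma iint_mono k (D : nat -> set R) (F G : (nat -> R) -> \bar R) :
  (forall theta, 0 <= F theta)%E ->
  (forall theta, (forall j, (j < k)%N -> D j (theta j)) -> F theta <= G theta)%E ->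
  (iint k D F <= iint k D G)%E.
Proof.
elim: k F G => [|k IH] F G F0 FG /=; first by apply: FG.
apply: integral_mono => t Dt; first exact: iint_ge0.
apply: IH => // theta Dtheta; apply: FG => j; rewrite /upd ltnS leq_eqVlt.
by case: eqVneq => [->|_] //= /Dtheta.
Qed.

Lemma eq_iint k D (F G : (nat -> R) -> \bar R) : F =1 G -> iint k D F = iint k D G.
Proof. by move=> FG; congr iint; exact/funext. Qed.

Lemma iintN k D (G : (nat -> R) -> \bar R) :
  (forall theta, 0 <= G theta)%E -> (iint k D (fun th => - G th) = - iint k D G)%E.
Proof.
elim: k G => [|k IH] G G0 //=; rewrite -integral_ge0N; last by move=> *; exact: iint_ge0.
by apply: eq_integral => t _; rewrite IH.
Qed.

Definition measD k (D : nat -> set R) := forall j, (j < k)%N -> measurable (D j).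

Lemma measDW k D : measD k.+1 D -> measD k D.
Proof. by move=> mD j jk; apply: mD; exact: ltnW. Qed.

(** The parameter space [T] is arbitrary so that the induction can move the outermost coordinate
    into it, passing from [T] to [T * R]. *)
Lemma measurable_iint k D {d} {T : measurableType d} (H : T -> (nat -> R) -> \bar R) :
  measD k D -> jmeas H -> (forall t theta, 0 <= H t theta)%E ->
  measurable_fun [set: T] (fun t => iint k D (H t)).
Proof.
elim: k d T H => [|k IH] d T H mD mH H0 /=.
  by apply: (mH _ _ id (fun _ _ => 0)) => // j; exact: measurable_cst.
(* Writing the domain as an indicator turns the outer integral into a Tonelli section over the whole
   line. *)
have -> : (fun t => \int[mu]_(x in D k) iint k D (fun theta => H t (upd theta k x)))%E =
  fubini_F mu (fun ts : T * measurableTypeR R =>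
    ((iint k D (fun theta => H ts.1 (upd theta k ts.2))) * (\1_(D k) ts.2)%:E)%E).
  apply/funext => t; rewrite /fubini_F [LHS]integral_mkcond; congr integral.
  by apply/funext => s; rewrite /patch /= indicE; case: ifPn => _; rewrite ?mule1 ?mule0.
apply: measurable_fun_fubini_tonelli_F; last first.
  by move=> ts; apply: mule_ge0; [exact: iint_ge0|rewrite lee_fin].
apply: emeasurable_funM.
  by apply: (IH _ _ (fun ts theta => H ts.1 (upd theta k ts.2)));
    [exact: measDW|exact: jmeas_upd|move=> *].
apply/measurable_EFinP; apply: measurableT_comp => //.
by apply: measurable_indic; apply: mD.
Qed.

Lemma measurable_iint_inner k D (G : (nat -> R) -> \bar R) :
  measD k D -> cmeas G -> (forall theta, 0 <= G theta)%E -> forall E,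
  measurable_fun E (fun s : measurableTypeR R => iint k D (fun th => G (upd th k s))).
Proof.
move=> mD mG G0 E; apply: (@measurable_funS _ _ _ _ setT) => //.
by apply: measurable_iint => //; apply: cmeas_updv.
Qed.

Lemma iintD k D (F G : (nat -> R) -> \bar R) : measD k D -> cmeas F -> cmeas G ->
  (forall theta, 0 <= F theta)%E -> (forall theta, 0 <= G theta)%E ->
  (iint k D (fun th => F th + G th) = iint k D F + iint k D G)%E.
Proof.
elim: k F G => [|k IH] F G mD mF mG F0 G0 //=.
rewrite -ge0_integralD//.
- by apply: eq_integral => t _; rewrite IH//; [exact: measDW|exact: cmeas_upd|exact: cmeas_upd].
- exact: mD.
- by move=> *; exact: iint_ge0.
- by apply: measurable_iint_inner => //; exact: measDW.
- by move=> *; exact: iint_ge0.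
- by apply: measurable_iint_inner => //; exact: measDW.
Qed.

Lemma iintZ k D (c : R) (G : (nat -> R) -> \bar R) : measD k D -> cmeas G ->
  0 <= c -> (forall theta, 0 <= G theta)%E ->
  (iint k D (fun th => c%:E * G th) = c%:E * iint k D G)%E.
Proof.
elim: k G => [|k IH] G mD mG c0 G0 //=.
rewrite -ge0_integralZl_EFin//.
- by apply: eq_integral => t _; rewrite IH//; [exact: measDW|exact: cmeas_upd].
- exact: mD.
- by move=> *; exact: iint_ge0.
- by apply: measurable_iint_inner => //; exact: measDW.
Qed.

Lemma iint_subset k (D E : nat -> set R) (G : (nat -> R) -> \bar R) :
  measD k D -> measD k E -> cmeas G -> (forall theta, 0 <= G theta)%E ->
  (forall j, (j < k)%N -> D j `<=` E j) -> (iint k D G <= iint k E G)%E.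
Proof.
elim: k G => [|k IH] G mD mE mG G0 DE //=.
apply: (@le_trans _ _ (\int[mu]_(t in D k) iint k E (fun th => G (upd th k t)))%E).
  apply: integral_mono => t _; first exact: iint_ge0.
  apply: IH => //; try exact: measDW; first exact: cmeas_upd.
  by move=> j jk; apply: DE; exact: ltnW.
apply: ge0_subset_integral; [exact: mD|exact: mE| |by move=> *; exact: iint_ge0|exact: DE].
by apply: measurable_iint_inner => //; exact: measDW.
Qed.

(** Tonelli for one extra real variable; iterating it gives the exchange of two iterated integrals
    in [iint_swap]. *)
Lemma iint_integral k D (E : set R) (H : measurableTypeR R -> (nat -> R) -> \bar R) :
  measD k D -> measurable E -> jmeas H -> (forall s theta, 0 <= H s theta)%E ->
  iint k D (fun th => \int[mu]_(s in E) H s th)%E = (\int[mu]_(s in E) iint k D (H s))%E.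
Proof.
elim: k H => [|k IH] H mD mE mH H0 //=.
transitivity (\int[mu]_(t in D k) \int[mu]_(s in E)
    iint k D (fun th => H s (upd th k t)))%E.
  apply: eq_integral => t _; apply: (IH (fun s th => H s (upd th k t))) => //.
    exact: measDW.
  move=> d' T' v u mv mu_; apply: mH => //.
  by apply: meas_coord_upd => //; exact: measurable_cst.
have mDk : measurable (D k) by exact: mD.
(* Both domains are absorbed as indicators, so that Tonelli applies on the full plane; [aux]
   translates back to integrals over sets. *)
pose f (ts : measurableTypeR R * measurableTypeR R) : \bar R :=
  ((\1_(D k) ts.1)%:E * (\1_E ts.2)%:E * iint k D (fun th => H ts.2 (upd th k ts.1)))%E.
have f0 ts : (0 <= f ts)%E by rewrite /f; apply: mule_ge0; [|exact: iint_ge0].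
have mf : measurable_fun setT f.
  apply: emeasurable_funM.
    apply: emeasurable_funM; apply/measurable_EFinP;
      by apply: measurableT_comp => //; exact: measurable_indic.
  apply: (measurable_iint _ _ (fun ts th => H ts.2 (upd th k ts.1))) => //.
    exact: measDW.
  move=> d' T' v u mv mu_; apply: mH; first exact: measurableT_comp.
  by apply: meas_coord_upd => //; exact: measurableT_comp.
have := fubini_tonelli (m1 := mu) (m2 := mu) f mf f0; rewrite /f /=.
have aux (A A' : set R) (h : R -> R -> \bar R) :
    (\int[mu]_(t in A) \int[mu]_(s in A') h t s =
     \int[mu]_t \int[mu]_s ((\1_A t)%:E * (\1_A' s)%:E * h t s))%E.
  rewrite [LHS]integral_mkcond; congr integral; apply/funext => t; rewrite /patch indicE.
  case: ifPn => tA; last first.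
    by rewrite integral0_eq// => s _; rewrite !mul0e.
  rewrite [LHS]integral_mkcond; congr integral; apply/funext => s.
  rewrite /patch indicE mul1e; by case: ifPn => sA; rewrite ?mul1e ?mul0e.
rewrite -aux => ->; rewrite [RHS]aux; congr integral; apply/funext => t.
congr integral; apply/funext => s; by rewrite (muleC (\1_E _)%:E).
Qed.

Lemma iint_swap p n D E (F : (nat -> R) -> (nat -> R) -> \bar R) :
  measD p D -> measD n E -> jmeas2 F -> (forall theta Y, 0 <= F theta Y)%E ->
  iint p D (fun th => iint n E (F th)) = iint n E (fun Y => iint p D (F^~ Y)).
Proof.
elim: p F => [|p IH] F mD mE mF F0 //=.
transitivity (\int[mu]_(t in D p) iint n E (fun Y => iint p D (fun th => F (upd th p t) Y)))%E.
  apply: eq_integral => t _; apply: (IH (fun th => F (upd th p t))) => //.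
    exact: measDW.
  move=> d' T' v u mv mu_; apply: mF => //.
  by apply: meas_coord_upd => //; exact: measurable_cst.
rewrite iint_integral//; first exact: mD.
  move=> d' T' v u mv mu_.
  apply: (measurable_iint _ _ (fun t' th => F (upd th p (v t')) (u t'))) => //.
    exact: measDW.
  move=> d'' T'' v' u' mv' mu'_; apply: mF.
    by apply: meas_coord_upd => //; exact: measurableT_comp.
  by move=> j; exact: (measurableT_comp (mu_ j)).
by move=> *; exact: iint_ge0.
Qed.

Lemma iint_prod k (D : nat -> set R) (h : nat -> R -> R) (c : nat -> R) :
  measD k D -> (forall j t, 0 <= h j t) ->
  (forall j, (j < k)%N -> measurable_fun [set: measurableTypeR R] (h j)) ->
  (forall j, (j < k)%N -> \int[mu]_(t in D j) (h j t)%:E = (c j)%:E)%E ->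
  iint k D (fun th => (\prod_(j < k) h j (th j))%:E) = (\prod_(j < k) c j)%:E.
Proof.
elim: k => [|k IH] mD h0 mh hc /=; first by rewrite !big_ord0.
have hck := hc k (ltnSn k).
transitivity (\int[mu]_(t in D k) ((\prod_(j < k) c j)%:E * (h k t)%:E))%E.
  apply: eq_integral => t _.
  rewrite -IH; [|exact: measDW|by []|by move=> j jk; apply: mh; exact: ltnW
    |by move=> j jk; apply: hc; exact: ltnW].
  rewrite muleC -iintZ//; last 3 first.
  - by exact: measDW.
  - apply/cmeasP => d' T' u mu_; apply/measurable_EFinP; apply: measurable_prod => j _.
    exact: (measurableT_comp (mh j (leqW (ltn_ord j))) (mu_ j)).
  - by move=> th; rewrite lee_fin prodr_ge0.
  apply: eq_iint => th; rewrite big_ord_recr /= mulrC EFinM /upd eqxx; congr (_ * _)%E.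
  by congr _%:E; apply: eq_bigr => j _; rewrite ltn_eqF.
rewrite ge0_integralZl_EFin//.
- by rewrite hck big_ord_recr.
- exact: mD.
- by move=> t _; rewrite lee_fin.
- apply/measurable_EFinP; apply: (@measurable_funS _ _ _ _ setT) => //; exact: mh.
- have c0 : forall j : 'I_k, 0 <= c j.
    move=> j; rewrite -lee_fin -hc; last exact: leqW.
    by apply: integral_ge0 => t _; rewrite lee_fin.
  by rewrite prodr_ge0.
Qed.

End IteratedIntegral.

(** * Bounds for ReLU networks *)

Section Network.
Context {R : realType} (d : nat).
Implicit Types (th : nat -> R) (x : 'rV[R]_d).

Lemma relu_norm (a : R) : `|relu a| <= `|a|.
Proof. by rewrite /relu; case: (leP a 0) => ha; rewrite ?normr0. Qed.

Lemma relu_lip (a b : R) : `|relu a - relu b| <= `|a - b|.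
Proof.
rewrite /relu; case: (leP a 0) => ha; case: (leP b 0) => hb; rewrite ?subrr ?normr0 //.
- by rewrite sub0r normrN gtr0_norm// distrC; apply: le_trans (ler_norm _); lra.
- by rewrite subr0 gtr0_norm//; apply: le_trans (ler_norm _); lra.
Qed.

(** The bias counts as one further summand, which is where [1 <= V] and the factor [n.+1] come
    from. *)
Lemma affine_bound n (a h : nat -> R) (b B V : R) : 0 <= B -> 1 <= V ->
  (forall j, (j < n)%N -> `|a j| <= B) -> (forall j, (j < n)%N -> `|h j| <= V) -> `|b| <= B ->
  `|\sum_(j < n) a j * h j + b| <= n.+1%:R * B * V.
Proof.
move=> B0 V1 ha hh hb; apply: (le_trans (ler_normD _ _)).
have : `|\sum_(j < n) a j * h j| <= n%:R * (B * V).
  apply: (le_trans (ler_norm_sum _ _ _)).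
  have -> : n%:R * (B * V) = \sum_(j < n) (B * V) by rewrite sumr_const card_ord mulr_natl.
  apply: ler_sum => j _; rewrite normrM; apply: ler_pM => //; [exact: ha|exact: hh].
have : B <= B * V by rewrite ler_peMr.
rewrite -natr1; nra.
Qed.

(** The splitting [a h - a' h' = (a - a') h + a' (h - h')] separates the perturbation of the weights
    from that of the inputs. *)
Lemma affine_lip n (a a' h h' : nat -> R) (b b' B V del E : R) : 0 <= B -> 1 <= V ->
  (forall j, (j < n)%N -> `|a' j| <= B) -> (forall j, (j < n)%N -> `|h j| <= V) ->
  (forall j, (j < n)%N -> `|a j - a' j| <= del) ->
  (forall j, (j < n)%N -> `|h j - h' j| <= E) -> `|b - b'| <= del -> 0 <= E ->
  `|(\sum_(j < n) a j * h j + b) - (\sum_(j < n) a' j * h' j + b')|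
    <= n.+1%:R * (del * V + B * E).
Proof.
move=> B0 V1 ha hh haa hhh hb E0.
have del0 : 0 <= del by apply: le_trans hb.
have -> : (\sum_(j < n) a j * h j + b) - (\sum_(j < n) a' j * h' j + b') =
   \sum_(j < n) ((a j - a' j) * h j + a' j * (h j - h' j)) + (b - b').
  have -> : \sum_(j < n) ((a j - a' j) * h j + a' j * (h j - h' j)) =
      \sum_(j < n) (a j * h j - a' j * h' j) by apply: eq_bigr => j _; ring.
  by rewrite sumrB; ring.
apply: (le_trans (ler_normD _ _)).
have : `|\sum_(j < n) ((a j - a' j) * h j + a' j * (h j - h' j))|
    <= n%:R * (del * V + B * E).
  apply: (le_trans (ler_norm_sum _ _ _)).
  have -> : n%:R * (del * V + B * E) = \sum_(j < n) (del * V + B * E).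
    by rewrite sumr_const card_ord mulr_natl.
  apply: ler_sum => j _; apply: (le_trans (ler_normD _ _)).
  rewrite !normrM; apply: lerD; apply: ler_pM => //;
    [exact: haa|exact: hh|exact: ha|exact: hhh].
have : del <= del * V by rewrite ler_peMr.
rewrite -natr1; nra.
Qed.

Lemma hoffS M t : hoff d M t.+1 = (hoff d M t + M * M + M)%N.
Proof. by rewrite /hoff; lia. Qed.

Lemma hoff_le M s t : (s <= t)%N -> (hoff d M s <= hoff d M t)%N.
Proof. by move=> st; rewrite /hoff leq_add2l leq_mul2r st orbT. Qed.

Lemma index_lt M N i j : (i < M)%N -> (j < N)%N -> (i * N + j < M * N)%N.
Proof.
move=> iM jN; have : (i.+1 * N <= M * N)%N by rewrite leq_mul2r iM orbT.
by rewrite mulSn; lia.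
Qed.

(** A network has at most a constant times [K M^2] parameters. Each will cost a logarithmic volume
    of order [K log n], hence the complexity [(K M)^2 log n]. *)
Lemma npar_le K M : (2 <= K)%N -> (1 <= M)%N -> (npar d K M <= (d + 3) * (K * (M * M)))%N.
Proof.
move=> hK hM; have [t ->] : exists t, K = t.+2 by exists (K - 2)%N; lia.
have hMM : (M <= M * M)%N by rewrite leq_pmull.
have hd : (M * d <= d * (M * M))%N by rewrite mulnC leq_mul2l hMM orbT.
have ht : (t * M <= t * (M * M))%N by rewrite leq_mul2l hMM orbT.
have := leq0n (d * t * (M * M)); move: hMM hd ht; rewrite /npar /hoff subn2 /=.
by rewrite !(mulnDl, mulnDr, mulSn, mulnS) -!mulnA; lia.
Qed.

Section Bounds.
Variables (K M : nat) (B : R) (x : 'rV[R]_d).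
Hypotheses (hK : (2 <= K)%N) (hB : 1 <= B) (hx : cube d x).
(** Growth factor of one layer: it dominates [(d+1) B] for the first layer and [(M+1) B] for the
    others. *)
Let Q : R := (M.+1 * d.+1)%:R * B.

Let Q1 : 1 <= Q.
Proof. by rewrite /Q -[leLHS]mulr1; apply: ler_pM => //; rewrite ler1n. Qed.

Let B0 : 0 <= B. Proof. exact: le_trans ler01 hB. Qed.

Let Q0 : 0 <= Q. Proof. exact: le_trans ler01 Q1. Qed.

Let hMQ : M.+1%:R * B <= Q.
Proof. by rewrite /Q ler_wpM2r// ler_nat leq_pmulr. Qed.

(** The input vector extended by zero to all indices, the form in which the affine bounds apply to
    the first layer. *)
Let xr (j : nat) : R := if insub j is Some i then x 0 i else 0.

Let hx1 j : (j < d)%N -> `|xr j| <= 1.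
Proof.
move=> jd; rewrite /xr insubT; have /andP[h0 h1] := hx (Sub j jd).
by rewrite ger0_norm.
Qed.

Let rowE (a : nat -> R) : \sum_(j < d) a j * x 0 j =
  \sum_(j < d) a j * xr j.
Proof. by apply: eq_bigr => j _; rewrite /xr valK. Qed.

Let first_w i j : (i < M)%N -> (j < d)%N -> (i * d + j < npar d K M)%N.
Proof.
move=> iM jd; have := index_lt M d i j iM jd; have := leq0n ((K - 2) * (M * M + M)).
by rewrite /npar /hoff; lia.
Qed.

Let first_b i : (i < M)%N -> (M * d + i < npar d K M)%N.
Proof. by have := leq0n ((K - 2) * (M * M + M)); rewrite /npar /hoff; lia. Qed.

Let hid_w t i j : (t.+1 <= K - 2)%N -> (i < M)%N -> (j < M)%N ->
  (hoff d M t + i * M + j < npar d K M)%N.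
Proof.
move=> /(hoff_le M) + iM jd; have := index_lt M M i j iM jd.
by rewrite hoffS /npar; lia.
Qed.

Let hid_b t i : (t.+1 <= K - 2)%N -> (i < M)%N ->
  (hoff d M t + M * M + i < npar d K M)%N.
Proof. by move=> /(hoff_le M) + iM; rewrite hoffS /npar; lia. Qed.

Lemma hid_bound th t i : bounded_par d K M B th -> (t <= K - 2)%N -> (i < M)%N ->
  `|hid d M th x t i| <= Q ^+ t.+1.
Proof.
move=> hth; elim: t i => [|t IH] i ht iM /=; apply: (le_trans (relu_norm _)).
  rewrite (rowE (fun j => th (i * d + j)%N)) (le_trans (affine_bound d (fun j => th (i * d + j)%N) _ _ B 1 B0 _ _ hx1 _))//.
  - by move=> j jd; apply: hth; exact: first_w.
  - by apply: hth; exact: first_b.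
  by rewrite mulr1 expr1 /Q ler_wpM2r// ler_nat; nia.
have Qt : 1 <= Q ^+ t.+1 by rewrite exprn_ege1.
rewrite (le_trans (affine_bound M (fun j => th (hoff d M t + i * M + j)%N) _ _ B (Q ^+ t.+1)
   B0 Qt _ (fun j jM => IH j (ltnW ht) jM) _))//.
- by move=> j jd; apply: hth; exact: hid_w.
- by apply: hth; exact: hid_b.
by rewrite [leRHS]exprS; apply: ler_wpM2r => //; exact: exprn_ge0.
Qed.

Lemma net_bound th : bounded_par d K M B th -> `|net d K M th x| <= Q ^+ K.
Proof.
move=> hth; have Qt : 1 <= Q ^+ (K - 2).+1 by rewrite exprn_ege1.
rewrite /net (le_trans (affine_bound M (fun j => th (hoff d M (K - 2) + j)%N) _ _ B
   (Q ^+ (K - 2).+1) B0 Qt _ (fun j jM => hid_bound th _ j hth (leqnn _) jM) _))//.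
- by move=> j jM; apply: hth; rewrite /npar; lia.
- by apply: hth; rewrite /npar; lia.
have -> : Q ^+ K = Q * Q ^+ (K - 2).+1 by rewrite -exprS; congr (_ ^+ _); lia.
by apply: ler_wpM2r => //; exact: exprn_ge0.
Qed.

(** Recursion for the error [del t Q^t] after [t] layers: the parameters of the new layer contribute
    one more unit, and the inherited error is multiplied by at most [(M+1) B <= Q]. *)
Let layer_step (del : R) t : 0 <= del ->
  M.+1%:R * (del * Q ^+ t.+1 + B * (del * t.+1%:R * Q ^+ t.+1)) <= del * t.+2%:R * Q ^+ t.+2.
Proof.
move=> del0; have Qt0 : 0 <= Q ^+ t.+1 by exact: exprn_ge0.
have dQ0 : 0 <= del * Q ^+ t.+1 by rewrite mulr_ge0.
have -> : del * t.+2%:R * Q ^+ t.+2 = Q * (t.+2%:R * (del * Q ^+ t.+1)).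
  by rewrite exprS; ring.
apply: (@le_trans _ _ (M.+1%:R * B * (t.+2%:R * (del * Q ^+ t.+1)))).
  rewrite -[leRHS]mulrA; apply: ler_wpM2l => //.
  have -> : B * (t.+2%:R * (del * Q ^+ t.+1)) =
      B * (del * Q ^+ t.+1) + B * (del * t.+1%:R * Q ^+ t.+1).
    by rewrite -[t.+2%:R]natr1; ring.
  by apply: lerD => //; rewrite ler_peMl.
by apply: ler_wpM2r => //; exact: mulr_ge0.
Qed.

Lemma hid_lip th th' (del : R) t i : 0 <= del ->
  bounded_par d K M B th -> bounded_par d K M B th' ->
  bounded_par d K M del (fun j => th j - th' j) ->
  (t <= K - 2)%N -> (i < M)%N ->
  `|hid d M th x t i - hid d M th' x t i| <= del * t.+1%:R * Q ^+ t.+1.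
Proof.
move=> del0 hth hth' hd; elim: t i => [|t IH] i ht iM /=; apply: (le_trans (relu_lip _ _)).
  rewrite (rowE (fun j => th (i * d + j)%N)) (rowE (fun j => th' (i * d + j)%N)).
  (* Both networks see the same input, bounded by 1, so the inherited error is 0 and [V = 1]. *)
  apply: (@le_trans _ _ (d.+1%:R * (del * 1 + B * 0))).
    apply: (affine_lip d (fun j => th (i * d + j)%N) (fun j => th' (i * d + j)%N) xr xr) => //.
    - by move=> j jd; apply: hth'; exact: first_w.
    - by move=> j jd; apply: (hd (i * d + j)%N); exact: first_w.
    - by move=> j jd; rewrite subrr normr0.
    - by apply: (hd (M * d + i)%N); exact: first_b.
  rewrite mulr0 addr0 !mulr1 expr1 mulrC ler_wpM2l//.
  by rewrite /Q -[leLHS]mulr1 ler_pM// ler_nat; nia.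
have Qt : 1 <= Q ^+ t.+1 by rewrite exprn_ege1.
apply: le_trans (layer_step del t del0).
apply: (affine_lip M (fun j => th (hoff d M t + i * M + j)%N)
    (fun j => th' (hoff d M t + i * M + j)%N)) => //.
- by move=> j jd; apply: hth'; exact: hid_w.
- by move=> j jd; apply: hid_bound => //; exact: ltnW.
- by move=> j jd; apply: (hd (hoff d M t + i * M + j)%N); exact: hid_w.
- by move=> j jd; apply: IH => //; exact: ltnW.
- by apply: (hd (hoff d M t + M * M + i)%N); exact: hid_b.
- by rewrite !mulr_ge0// (le_trans _ Qt).
Qed.

Lemma net_lip th th' (del : R) : 0 <= del ->
  bounded_par d K M B th -> bounded_par d K M B th' ->
  bounded_par d K M del (fun j => th j - th' j) ->
  `|net d K M th x - net d K M th' x| <= del * K%:R * Q ^+ K.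
Proof.
move=> del0 hth hth' hd; have Qt : 1 <= Q ^+ (K - 2).+1 by rewrite exprn_ege1.
(* The output layer is one more application of the recursion, without ReLU. *)
have -> : del * K%:R * Q ^+ K = del * (K - 2).+2%:R * Q ^+ (K - 2).+2.
  by have -> : (K - 2).+2 = K by lia.
apply: le_trans (layer_step del _ del0).
apply: (affine_lip M (fun j => th (hoff d M (K - 2) + j)%N)
    (fun j => th' (hoff d M (K - 2) + j)%N)) => //.
- by move=> j jM; apply: hth'; rewrite /npar; lia.
- by move=> j jM; apply: hid_bound.
- by move=> j jM; apply: (hd (hoff d M (K - 2) + j)%N); rewrite /npar; lia.
- by move=> j jM; apply: hid_lip.
- by apply: (hd (hoff d M (K - 2) + M)%N); rewrite /npar; lia.
- by rewrite !mulr_ge0// (le_trans _ Qt).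
Qed.

End Bounds.

Lemma measurable_hid {dd} {T : measurableType dd} (u : T -> nat -> R) M x t i :
  meas_coord u -> measurable_fun [set: T] (fun s => hid d M (u s) x t i).
Proof.
move=> mu_; elim: t i => [|t IH] i /=; apply: measurable_maxr => //.
  apply: measurable_funD => //; apply: measurable_sum => j.
  by apply: measurable_funM.
apply: measurable_funD => //; apply: measurable_sum => j.
by apply: measurable_funM.
Qed.

Lemma measurable_net {dd} {T : measurableType dd} (u : T -> nat -> R) K M x :
  meas_coord u -> measurable_fun [set: T] (fun s => net d K M (u s) x).
Proof.
move=> mu_; apply: measurable_funD => //; apply: measurable_sum => j.
by apply: measurable_funM => //; exact: measurable_hid.
Qed.

End Network.

(** * Gaussian likelihoods *)

Section Gaussian.
Context {R : realType} (d : nat) (X : nat -> nat -> 'rV[R]_d) (n : nat).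
Implicit Types (f g : 'rV[R]_d -> R) (Y v : nat -> R).
Let c0 : R := normal_peak 1.

(** Negative log-likelihood. It is nonnegative because the peak of the standard normal density is at
    most 1, so it can be handled by the theory of nonnegative integrals. *)
Definition nll f Y : R :=
  n%:R * - ln c0 + 2^-1 * \sum_(i < n) (Y i - f (X n i)) ^+ 2.

(** Exponential of an affine form in the noise [Z]; every random quantity in the proof is bounded
    through such exponentials. *)
Definition tilt (a : R) v f Y : R := expR (a + \sum_(i < n) v i * (Y i - f (X n i))).

Let c0_gt0 : 0 < c0. Proof. by apply: normal_peak_gt0; rewrite oner_eq0. Qed.

Let c0_le1 : c0 <= 1.
Proof.
have h : 1 <= Num.sqrt (1 ^+ 2 * pi *+ 2 : R).
  rewrite -[leLHS]sqrtr1 ler_wsqrtr// expr1n mul1r mulr2n.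
  by have := @pi_ge2 R; lra.
by rewrite /c0 /normal_peak invf_le1// (lt_le_trans ltr01).
Qed.

Lemma phiE (y : R) : phi y = c0 * expR (- (2^-1 * y ^+ 2)).
Proof.
rewrite /phi normal_pdfE ?oner_eq0// /normal_fun subr0 expr1n; congr (_ * expR _).
by field.
Qed.

Lemma likE f Y : lik d X n f Y = expR (- nll f Y).
Proof.
rewrite /lik /nll opprD expRD mulrN opprK expRM_natl lnK ?posrE//.
under eq_bigr do rewrite phiE.
rewrite big_split /= prodr_const card_ord -expR_sum; congr (_ * expR _).
by rewrite mulr_sumr sumrN.
Qed.

Lemma lik_gt0 f Y : 0 < lik d X n f Y.
Proof. by rewrite likE expR_gt0. Qed.

Lemma ln_lik f Y : ln (lik d X n f Y) = - nll f Y.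
Proof. by rewrite likE expRK. Qed.

Lemma nll_ge0 f Y : 0 <= nll f Y.
Proof.
rewrite addr_ge0// mulr_ge0 ?ler0n ?invr_ge0 ?ler0n//.
  by rewrite oppr_ge0 ln_le0.
by apply: sumr_ge0 => i _; exact: sqr_ge0.
Qed.

Lemma nll_shift f g Y : nll g Y = nll f Y
  - \sum_(i < n) (g (X n i) - f (X n i)) * (Y i - f (X n i))
  + 2^-1 * \sum_(i < n) (g (X n i) - f (X n i)) ^+ 2.
Proof.
rewrite /nll -!addrA; congr (_ + _); rewrite !mulr_sumr -sumrN -!big_split /=.
by apply: eq_bigr => i _; field.
Qed.

(** Completing the square in each coordinate: [exp (v z)] times the density of [N(f, 1)] is
    [exp (v^2 / 2)] times the density of [N(f + v, 1)], and the product then factorises. *)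
Lemma Egauss_tilt a v f : Egauss d X n f (fun Y => (tilt a v f Y)%:E) =
  (expR (a + 2^-1 * \sum_(i < n) v i ^+ 2))%:E.
Proof.
pose h j t := expR (2^-1 * v j ^+ 2) * normal_pdf (f (X n j) + v j) 1 t.
have h0 j t : 0 <= h j t by rewrite mulr_ge0 ?expR_ge0 ?normal_pdf_ge0.
have mh j : measurable_fun [set: measurableTypeR R] (h j).
  by apply: measurable_funM => //; exact: measurable_normal_pdf.
have mD : measD n (fun _ => [set: R]) by move=> j _; exact: measurableT.
rewrite /Egauss.
transitivity (iint n (fun _ => [set: R])
    (fun Y => (expR a)%:E * (\prod_(j < n) h j (Y j))%:E)%E).
  apply: eq_iint => Y; rewrite -!EFinM; congr _%:E.
  rewrite /tilt expRD -mulrA; congr (_ * _); rewrite expR_sum /lik -big_split /=.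
  apply: eq_bigr => i _; rewrite phiE /h normal_pdfE ?oner_eq0// /normal_fun.
  rewrite mulrCA [RHS]mulrCA; congr (_ * _); rewrite -!expRD; congr expR.
  by rewrite expr1n; field.
rewrite iintZ ?expR_ge0//; last 2 first.
- apply/cmeasP => d' T' u mu_; apply/measurable_EFinP; apply: measurable_prod => j _.
  exact: (measurableT_comp (mh j) (mu_ j)).
- by move=> Y; rewrite lee_fin prodr_ge0.
rewrite (iint_prod _ _ _ (fun j => expR (2^-1 * v j ^+ 2)))//; last first.
  move=> j _; rewrite /h; under eq_integral do rewrite EFinM.
  rewrite ge0_integralZl_EFin ?expR_ge0//.
  - by rewrite integral_normal_pdf mule1.
  - by move=> t _; rewrite lee_fin normal_pdf_ge0.
  - by apply/measurable_EFinP; exact: measurable_normal_pdf.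
by rewrite -EFinM -expR_sum -expRD mulr_sumr.
Qed.

Lemma measurable_nll {dd} {T : measurableType dd} (g : T -> 'rV[R]_d -> R) (y : T -> nat -> R) :
  meas_coord y -> (forall x, measurable_fun [set: T] (fun t => g t x)) ->
  measurable_fun [set: T] (fun t => nll (g t) (y t)).
Proof.
move=> my mg; apply: measurable_funD => //; apply: measurable_funM => //.
by apply: measurable_sum => i; apply: measurable_funX; exact: measurable_funB.
Qed.

Lemma measurable_lik {dd} {T : measurableType dd} (g : T -> 'rV[R]_d -> R) (y : T -> nat -> R) :
  meas_coord y -> (forall x, measurable_fun [set: T] (fun t => g t x)) ->
  measurable_fun [set: T] (fun t => lik d X n (g t) (y t)).
Proof.
move=> my mg; under eq_fun do rewrite likE.
by apply: measurableT_comp => //; apply: measurableT_comp => //; exact: measurable_nll.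
Qed.

Lemma measurable_tilt {dd} {T : measurableType dd} (a : T -> R) (v y : T -> nat -> R) f :
  measurable_fun [set: T] a -> meas_coord v -> meas_coord y ->
  measurable_fun [set: T] (fun t => tilt (a t) (v t) f (y t)).
Proof.
move=> ma mv my; apply: measurableT_comp => //; apply: measurable_funD => //.
by apply: measurable_sum => i; apply: measurable_funM => //; exact: measurable_funB.
Qed.

Lemma tilt_ge0 a v f Y : 0 <= tilt a v f Y. Proof. exact: expR_ge0. Qed.

Section Expectation.
Variable f : 'rV[R]_d -> R.
Local Notation EG := (Egauss d X n f).

Let lik0 Y : (0 <= (lik d X n f Y)%:E)%E.
Proof. by rewrite lee_fin ltW// lik_gt0. Qed.

Let mT : measD n (fun _ => [set: R]).
Proof. by move=> j _; exact: measurableT. Qed.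

Let mlik : cmeas (fun Y => (lik d X n f Y)%:E).
Proof.
apply/cmeasP => d' T' u mu_; apply/measurable_EFinP.
by apply: measurable_lik => // x; exact: measurable_cst.
Qed.

Let cmM (G : (nat -> R) -> \bar R) : cmeas G ->
  cmeas (fun Y => G Y * (lik d X n f Y)%:E)%E.
Proof.
by move=> mG d' T' u v mu_ mv; apply: emeasurable_funM; [exact: (mG _ _ u)|exact: (mlik _ _ u)].
Qed.

Lemma Egauss_mono (F G : (nat -> R) -> \bar R) : (forall Y, 0 <= F Y)%E ->
  (forall Y, F Y <= G Y)%E -> (EG F <= EG G)%E.
Proof.
move=> F0 FG; apply: iint_mono => [Y|Y _]; first exact: mule_ge0.
exact: lee_wpmul2r.
Qed.

Lemma EgaussD (F G : (nat -> R) -> \bar R) : cmeas F -> cmeas G ->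
  (forall Y, 0 <= F Y)%E -> (forall Y, 0 <= G Y)%E ->
  (EG (fun Y => F Y + G Y) = EG F + EG G)%E.
Proof.
move=> mF mG F0 G0; rewrite /Egauss -iintD//.
- by apply: eq_iint => Y; rewrite ge0_muleDl.
- exact: cmM.
- exact: cmM.
- by move=> Y; exact: mule_ge0.
- by move=> Y; exact: mule_ge0.
Qed.

Lemma EgaussZ c (G : (nat -> R) -> \bar R) : cmeas G -> 0 <= c ->
  (forall Y, 0 <= G Y)%E -> (EG (fun Y => c%:E * G Y) = c%:E * EG G)%E.
Proof.
move=> mG c0' G0; rewrite /Egauss -iintZ//.
- by apply: eq_iint => Y; rewrite muleA.
- exact: cmM.
- by move=> Y; exact: mule_ge0.
Qed.

(** That the likelihood has total mass 1 is read off from the zero tilt. *)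
Lemma Egauss_cst (c : R) : 0 <= c -> EG (fun _ => c%:E) = c%:E.
Proof.
move=> c1; have h := Egauss_tilt 0 (fun=> 0) f.
transitivity (EG (fun Y => c%:E * (tilt 0 (fun=> 0) f Y)%:E)%E).
  apply: eq_iint => Y; rewrite /tilt big1 ?add0r ?expR0 ?mule1// => i _.
  by rewrite mul0r.
rewrite EgaussZ//.
- rewrite h big1 ?mulr0 ?addr0 ?expR0 ?mule1// => i _.
  by rewrite expr0n.
- apply/cmeasP => d' T' u mu_; apply/measurable_EFinP; apply: measurable_tilt.
  + exact: measurable_cst.
  + by move=> j; exact: measurable_cst.
  + exact: mu_.
- by move=> Y; rewrite lee_fin tilt_ge0.
Qed.

Lemma Egauss_sum (I : Type) (s : seq I) (F : I -> (nat -> R) -> \bar R) :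
  (forall i, cmeas (F i)) -> (forall i Y, 0 <= F i Y)%E ->
  (EG (fun Y => \sum_(i <- s) F i Y) = \sum_(i <- s) EG (F i))%E.
Proof.
move=> mF F0; elim: s => [|i s IH].
  under [in LHS]eq_fun do rewrite big_nil.
  by rewrite big_nil; exact: Egauss_cst.
rewrite big_cons -IH -EgaussD//.
- by apply: eq_iint => Y; rewrite big_cons.
- move=> d' T' v u mv mu_; apply: (emeasurable_sum s (h := fun j t => F j (u t))) => j.
  exact: (mF j _ _ v u).
- by move=> Y; exact: sume_ge0.
Qed.

Lemma Egauss_iint p D (F : (nat -> R) -> (nat -> R) -> \bar R) : measD p D -> jmeas2 F ->
  (forall th Y, 0 <= F th Y)%E ->
  EG (fun Y => iint p D (F^~ Y)) = iint p D (fun th => EG (F th)).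
Proof.
move=> mD mF F0; rewrite /Egauss iint_swap//.
- apply: eq_iint => Y; rewrite muleC -iintZ//.
  + by apply: eq_iint => th; rewrite muleC.
  + move=> d' T' v u mv mu_; apply: mF => // j; exact: measurable_cst.
  + by rewrite -lee_fin.
- by move=> d' T' v u mv mu_; apply: emeasurable_funM; [exact: mF|exact: (mlik _ _ (fun=> tt))].
- by move=> *; exact: mule_ge0.
Qed.

End Expectation.
End Gaussian.

(** * Uniform laws on boxes and the variational objective *)

Section Boxes.
Context {R : realType}.
Implicit Types (psi : (nat -> R) * (nat -> R)) (G : (nat -> R) -> \bar R).

Definition proper_box p psi : Prop := forall j, (j < p)%N -> psi.1 j < psi.2 j.

Definition in_box p psi (th : nat -> R) : Prop := forall j, (j < p)%N -> box psi j (th j).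

Lemma valid_box_proper p B psi : valid_box p B psi -> proper_box p psi.
Proof. by move=> h j /h[_ []]. Qed.

Lemma valid_box_bounded p B psi th : valid_box p B psi -> in_box p psi th ->
  forall j, (j < p)%N -> `|th j| <= B.
Proof.
move=> h hth j jp; have := hth j jp; have [h1 [_ h2]] := h j jp.
by rewrite /box /= in_itv /= ler_norml => /andP[h3 h4]; apply/andP; split; lra.
Qed.

Lemma measD_box p psi : measD p (box psi).
Proof. by move=> j _; exact: measurable_itv. Qed.

Lemma boxvol_gt0 p psi : proper_box p psi -> 0 < boxvol p psi.
Proof. by move=> h; apply: prodr_gt0 => j _; rewrite subr_gt0; exact: h. Qed.

Lemma boxvol_le p psi B : valid_box p B psi -> boxvol p psi <= (B *+ 2) ^+ p.
Proof.
move=> h; rewrite -[in leRHS](card_ord p) -prodr_const; apply: ler_prod => j _.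
by have [h1 [h2 h3]] := h j (ltn_ord j); apply/andP; split; rewrite ?mulr2n; lra.
Qed.

Lemma iint_box_cst p psi (c : R) : proper_box p psi -> 0 <= c ->
  iint p (box psi) (fun _ => c%:E) = (c * boxvol p psi)%:E.
Proof.
move=> h c0.
transitivity (iint p (box psi) (fun th => c%:E * (\prod_(j < p) (fun _ _ => 1) j (th j))%:E)%E).
  by apply: eq_iint => th; rewrite big1// mule1.
rewrite iintZ//.
- rewrite (iint_prod p (box psi) (fun _ _ => 1) (fun j => psi.2 j - psi.1 j))//.
  + exact: measD_box.
  + move=> j jp; have := integral_cst (@lebesgue_measure R) (measD_box p psi j jp) 1%E.
    rewrite /cst => ->; rewrite mul1e /box.
    by apply: (etrans (lebesgue_measure_itv _)); rewrite /= lte_fin h// EFinB.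
- exact: measD_box.
- by move=> th; rewrite lee_fin prodr_ge0.
Qed.

Section Fixed.
Variables (p : nat) (psi : (nat -> R) * (nat -> R)).
Hypothesis hpsi : proper_box p psi.

Let V0 : 0 <= (boxvol p psi)^-1.
Proof. by rewrite invr_ge0 ltW// boxvol_gt0. Qed.

Lemma Ebox_ge0 G : (forall th, 0 <= G th)%E -> (0 <= Ebox p psi G)%E.
Proof. by move=> G0; apply: mule_ge0; rewrite ?lee_fin//; exact: iint_ge0. Qed.

Lemma Ebox_cst (c : R) : 0 <= c -> Ebox p psi (fun _ => c%:E) = c%:E.
Proof.
move=> c0; rewrite /Ebox iint_box_cst// -EFinM mulfK//.
by rewrite gt_eqF// boxvol_gt0.
Qed.

Lemma Ebox_mono F G : (forall th, 0 <= F th)%E ->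
  (forall th, in_box p psi th -> F th <= G th)%E -> (Ebox p psi F <= Ebox p psi G)%E.
Proof.
by move=> F0 FG; apply: lee_wpmul2r; rewrite ?lee_fin//; exact: iint_mono.
Qed.

Lemma EboxD F G : cmeas F -> cmeas G -> (forall th, 0 <= F th)%E ->
  (forall th, 0 <= G th)%E ->
  (Ebox p psi (fun th => F th + G th) = Ebox p psi F + Ebox p psi G)%E.
Proof.
move=> mF mG F0 G0; rewrite /Ebox iintD//; last exact: measD_box.
by rewrite ge0_muleDl//; exact: iint_ge0.
Qed.

Lemma EboxZ (c : R) G : cmeas G -> 0 <= c -> (forall th, 0 <= G th)%E ->
  (Ebox p psi (fun th => c%:E * G th) = c%:E * Ebox p psi G)%E.
Proof.
by move=> mG c0 G0; rewrite /Ebox iintZ//; [rewrite muleA|exact: measD_box].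
Qed.

Lemma Ebox_fin G (c : R) : (forall th, 0 <= G th)%E ->
  (forall th, in_box p psi th -> G th <= c%:E)%E ->
  exists2 e : R, Ebox p psi G = e%:E & 0 <= e.
Proof.
move=> G0 Gc; have h0 := Ebox_ge0 _ G0.
have h1 : (Ebox p psi G <= (Num.max c 0)%:E)%E.
  rewrite -Ebox_cst ?le_max ?lexx ?orbT//; apply: Ebox_mono => // th hth.
  by apply: (le_trans (Gc th hth)); rewrite lee_fin le_max lexx.
move: h0 h1; case: (Ebox p psi G) => // e; rewrite !lee_fin => h0 _.
by exists e.
Qed.

(** Jensen's inequality from the tangent of the exponential at [- e], namely
    [exp (- g) >= exp (- e) (1 + e - g)]. *)
Lemma Ebox_jensen (g : (nat -> R) -> R) (e : R) : cmeas (fun th => (g th)%:E) ->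
  (forall th, 0 <= g th) -> Ebox p psi (fun th => (g th)%:E) = e%:E -> 0 <= e ->
  ((expR (- e))%:E <= Ebox p psi (fun th => (expR (- g th))%:E))%E.
Proof.
move=> mg g0 he e0.
have me : cmeas (fun th => (expR (- g th))%:E).
  apply/cmeasP => d' T' u mu_; apply/measurable_EFinP; apply: measurableT_comp => //.
  apply: measurableT_comp => //; apply/measurable_EFinP.
  exact: (proj1 (cmeasP _) mg).
(* The tangent inequality with its negative term moved to the other side, so that only nonnegative
   functions are integrated. *)
have H : ((expR (- e) * (1 + e))%:E <=
   Ebox p psi (fun th => (expR (- g th))%:E) + (expR (- e))%:E * e%:E)%E.
  rewrite -[in leRHS]he -EboxZ ?expR_ge0// -EboxD//.
  - have c0 : 0 <= expR (- e) * (1 + e) by rewrite mulr_ge0 ?expR_ge0 ?addr_ge0.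
    rewrite -(Ebox_cst _ c0); apply: Ebox_mono => th; first by rewrite lee_fin mulr_ge0 ?expR_ge0 ?addr_ge0.
    move=> _; rewrite -EFinM -EFinD lee_fin -lerBlDr -mulrBr.
    rewrite (_ : - g th = - e + (e - g th)); last by ring.
    rewrite expRD; apply: ler_wpM2l; first exact: expR_ge0.
    by apply: le_trans (expR_ge1Dx _); lra.
  - apply/cmeasP => d' T' u mu_; apply: emeasurable_funM; first exact: measurable_cst.
    exact: (proj1 (cmeasP _) mg).
  - by move=> th; rewrite mule_ge0 ?lee_fin ?expR_ge0.
by move: H; rewrite mulrDr mulr1 EFinD -EFinM leeD2rE.
Qed.

End Fixed.

Definition prior_box (B : R) : (nat -> R) * (nat -> R) := (fun=> - B, fun=> B).

Lemma prior_box_valid p B : 0 < B -> valid_box p B (prior_box B).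
Proof. by move=> B0 j _ /=; split => //; split => //; lra. Qed.

(** The law on a box has a density with respect to the prior bounded by the ratio of volumes. *)
Lemma Ebox_le_prior p psi (B : R) G : valid_box p B psi -> 0 < B -> cmeas G ->
  (forall th, 0 <= G th)%E ->
  (Ebox p psi G <= ((B *+ 2) ^+ p / boxvol p psi)%:E * Ebox p (prior_box B) G)%E.
Proof.
move=> h B0 mG G0; have hp := valid_box_proper _ _ _ h.
have -> : (((B *+ 2) ^+ p / boxvol p psi)%:E * Ebox p (prior_box B) G =
   iint p (box (prior_box B)) G * ((boxvol p psi)^-1)%:E)%E.
  rewrite /Ebox /boxvol /prior_box /= prodr_const card_ord opprK -mulr2n.
  rewrite muleC -muleA -EFinM mulrA mulVf ?mul1r//.
  by rewrite expf_neq0// mulrn_eq0 /= gt_eqF.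
apply: lee_wpmul2r; first by rewrite lee_fin invr_ge0 ltW// boxvol_gt0.
apply: iint_subset => //; [exact: measD_box|exact: measD_box|].
move=> j jp t; rewrite /box /prior_box /= !in_itv /= => /andP[h1 h2].
by have [h3 [_ h4]] := h j jp; apply/andP; split; lra.
Qed.

Section Near.
Variables (p : nat) (B del : R) (th0 : nat -> R).
Hypotheses (hdel : 0 < del) (hdelB : del <= B)
  (hth0 : forall j, (j < p)%N -> `|th0 j| <= B).

(** A cell of side [del] containing [th0]. Clamping its left end at [- B] keeps it inside the
    parameter cube even when [th0] lies near the boundary, without changing its volume. *)
Definition near_box : (nat -> R) * (nat -> R) :=
  (fun j => Num.max (- B) (th0 j - del), fun j => Num.max (- B) (th0 j - del) + del).

Lemma near_box_valid : valid_box p B near_box.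
Proof.
move: (hdel) (hdelB) => hd hdB j jp; have := hth0 j jp; rewrite ler_norml => /andP[h1 h2] /=.
by case: (leP (- B) (th0 j - del)) => h3; split; [|split| |split]; lra.
Qed.

Lemma near_box_vol : boxvol p near_box = del ^+ p.
Proof.
rewrite -[in RHS](card_ord p) -prodr_const; apply: eq_bigr => j _ /=; ring.
Qed.

Lemma near_box_dist th : in_box p near_box th ->
  forall j, (j < p)%N -> `|th j - th0 j| <= del.
Proof.
move: (hdel) (hdelB) => hd hdB h j jp; have := h j jp; have := hth0 j jp.
rewrite ler_norml /box /near_box /= in_itv /= ler_norml => /andP[h1 h2].
by case: (leP (- B) (th0 j - del)) => h3 /andP[h4 h5]; apply/andP; split; lra.
Qed.

End Near.
End Boxes.

(** * Bounds for the variational objective *)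

Section Elbo.
Context {R : realType} (d : nat) (X : nat -> nat -> 'rV[R]_d) (n : nat).
Hypothesis hX : forall i, (i < n)%N -> cube d (X n i).
Variables (K M : nat) (B : R).
Hypotheses (hK : (2 <= K)%N) (hB : 1 <= B).
Let p := npar d K M.
Let B0 : 0 < B. Proof. exact: lt_le_trans ltr01 hB. Qed.

Lemma cmeas_nll Y : cmeas (fun th => (nll d X n (net d K M th) Y)%:E).
Proof.
apply/cmeasP => d' T' u mu_; apply/measurable_EFinP; apply: measurable_nll.
  by move=> j; exact: measurable_cst.
by move=> x; exact: measurable_net.
Qed.

Lemma jmeas2_tilt (a : (nat -> R) -> R) (v : (nat -> R) -> nat -> R) f :
  (forall d' (T' : measurableType d') (u : T' -> nat -> R), meas_coord u ->
     measurable_fun [set: T'] (fun t => a (u t))) ->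
  (forall d' (T' : measurableType d') (u : T' -> nat -> R), meas_coord u ->
     meas_coord (fun t => v (u t))) ->
  jmeas2 (fun th Y => (tilt d X n (a th) (v th) f Y)%:E).
Proof.
move=> ma mv d' T' w u mw mu_; apply/measurable_EFinP; apply: measurable_tilt => //.
  exact: ma.
exact: mv.
Qed.

(** Makes the objective finite, so that it can be treated as a real number. *)
Lemma nll_net_bounded Y : exists c, forall th, bounded_par d K M B th ->
  nll d X n (net d K M th) Y <= c.
Proof.
pose Q : R := (M.+1 * d.+1)%:R * B.
exists (n%:R * - ln (normal_peak 1) + 2^-1 * \sum_(i < n) (`|Y i| + Q ^+ K) ^+ 2).
move=> th hth; rewrite /nll lerD2l ler_wpM2l ?invr_ge0 ?ler0n//.
apply: ler_sum => i _; rewrite -[leLHS]real_normK ?num_real//.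
have h : `|Y i - net d K M th (X n i)| <= `|Y i| + Q ^+ K.
  by apply: (le_trans (ler_normB _ _)); rewrite lerD2l; apply: net_bound => //; exact: hX.
by apply: lerXn2r => //; rewrite nnegrE//; exact: le_trans h.
Qed.

Definition klr (psi : (nat -> R) * (nat -> R)) : R :=
  ln ((boxvol p psi)^-1 / ((B *+ 2) ^+ p)^-1).

Lemma expR_klr psi : valid_box p B psi -> expR (klr psi) = (B *+ 2) ^+ p / boxvol p psi.
Proof.
move=> /valid_box_proper/boxvol_gt0 h; rewrite /klr lnK ?invrK 1?mulrC//.
by rewrite posrE mulr_gt0 ?invr_gt0// exprn_gt0// mulrn_wgt0.
Qed.

Lemma klr_ge0 psi : valid_box p B psi -> 0 <= klr psi.
Proof.
move=> h; have h0 := boxvol_gt0 _ _ (valid_box_proper _ _ _ h).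
by rewrite -ler_expR expR0 expR_klr// ler_pdivlMr// mul1r boxvol_le.
Qed.

Lemma Ebox_nll_fin Y psi : valid_box p B psi ->
  exists2 e : R, Ebox p psi (fun th => (nll d X n (net d K M th) Y)%:E) = e%:E & 0 <= e.
Proof.
move=> h; have [c hc] := nll_net_bounded Y.
apply: (Ebox_fin _ _ (valid_box_proper _ _ _ h) _ c).
  by move=> th; rewrite lee_fin nll_ge0.
by move=> th hth; rewrite lee_fin; apply: hc => j jp; exact: valid_box_bounded hth j jp.
Qed.

Lemma ELBOobjE Y psi : valid_box p B psi ->
  ELBOobj d X n K M B Y psi =
  (Ebox p psi (fun th => (nll d X n (net d K M th) Y)%:E) + (klr psi)%:E)%E.
Proof.
move=> h; rewrite /ELBOobj /KLbox Ebox_cst ?klr_ge0//; last exact: valid_box_proper h.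
congr (_ + _)%E; rewrite /Ebox -mulNe; congr (_ * _)%E.
rewrite -[RHS]oppeK -(iintN _ _ (fun th => (nll d X n (net d K M th) Y)%:E)); last by move=> th; rewrite lee_fin nll_ge0.
by congr (- _)%E; apply: eq_iint => th; rewrite ln_lik.
Qed.

Lemma ELBOobj_fin Y psi : valid_box p B psi ->
  ELBOobj d X n K M B Y psi = (fine (ELBOobj d X n K M B Y psi))%:E.
Proof.
move=> h; rewrite ELBOobjE//; have [e -> _] := Ebox_nll_fin Y psi h.
by rewrite -EFinD.
Qed.

(** The evidence lower bound: Jensen under the box law gives the fit term, and passing from the box
    to the prior costs exactly the exponential of the Kullback-Leibler term. *)
Lemma evidence_bound Y psi : valid_box p B psi ->
  ((expR (- fine (ELBOobj d X n K M B Y psi)))%:E <=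
   Ebox p (prior_box B) (fun th => (lik d X n (net d K M th) Y)%:E))%E.
Proof.
move=> h; have hp := valid_box_proper _ _ _ h.
rewrite ELBOobjE//; have [e he e0] := Ebox_nll_fin Y psi h.
rewrite he /= opprD expRD.
have hE : ((expR (- e))%:E <= (expR (klr psi))%:E *
    Ebox p (prior_box B) (fun th => (lik d X n (net d K M th) Y)%:E))%E.
  have -> : (fun th => (lik d X n (net d K M th) Y)%:E) =
            (fun th => (expR (- nll d X n (net d K M th) Y))%:E).
    by apply/funext => th; rewrite likE.
  apply: (le_trans (Ebox_jensen p psi hp (fun th => nll d X n (net d K M th) Y) e
     (cmeas_nll Y) _ he e0)).
    by move=> th; exact: nll_ge0.
  rewrite expR_klr//; apply: Ebox_le_prior => //.
  apply/cmeasP => d' T' u mu_; apply/measurable_EFinP; apply: measurableT_comp => //.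
  apply: measurableT_comp => //; apply: measurable_nll.
    by move=> j; exact: measurable_cst.
  by move=> x; exact: measurable_net.
by rewrite EFinM muleC (expRN (klr psi)) lee_pdivrMl ?expR_gt0.
Qed.

(** Integrates a pointwise bound on the cube against the box law and uses that the Kullback-Leibler
    term is nonnegative. The slack [S] stands on the right so that both sides are sums of
    nonnegative terms. *)
Lemma energy_lower Y psi (A : set (nat -> R)) (L S k : R) : valid_box p B psi ->
  cmeas (fun th => (\1_A th)%:E) -> 0 <= L -> 0 <= S -> 0 <= k ->
  (forall th, bounded_par d K M B th ->
     L + k * \1_A th <= nll d X n (net d K M th) Y + S) ->
  L + k * fine (Ebox p psi (fun th => (\1_A th)%:E)) <= fine (ELBOobj d X n K M B Y psi) + S.
Proof.
move=> h mA L0 S0 k0 hn; have hp := valid_box_proper _ _ _ h.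
have [xi hxi xi0] : exists2 e : R, Ebox p psi (fun th => (\1_A th)%:E) = e%:E & 0 <= e.
  apply: (Ebox_fin _ _ hp _ 1) => th; rewrite ?lee_fin ?indicE ?ler0n//.
  by case: (_ \in _).
rewrite ELBOobjE//; have [e he e0] := Ebox_nll_fin Y psi h.
rewrite he hxi /=; apply: (@le_trans _ _ (e + S)); last first.
  by rewrite lerD2r lerDl klr_ge0.
rewrite -lee_fin EFinD EFinM -hxi [leRHS]EFinD -he.
rewrite -(EboxZ p psi)//.
rewrite -{1}(Ebox_cst p psi hp _ L0) -(Ebox_cst p psi hp _ S0).
have mc c : cmeas (fun _ : nat -> R => c%:E : \bar R).
  by apply/cmeasP => *; exact: measurable_cst.
have k1 th : (0 <= k%:E * (\1_A th)%:E)%E by rewrite -EFinM lee_fin mulr_ge0// indicE ler0n.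
rewrite -!EboxD//; last 3 first.
- exact: cmeas_nll.
- by move=> th; rewrite lee_fin nll_ge0.
- apply/cmeasP => d' T' u mu_; apply: emeasurable_funM; first exact: measurable_cst.
  exact: (proj1 (cmeasP _) mA).
apply: Ebox_mono => // th; first exact: adde_ge0.
move=> hth; rewrite -EFinM -!EFinD lee_fin; apply: hn => j jp.
exact: valid_box_bounded hth j jp.
Qed.

Lemma energy_upper Y psi (c : R) : valid_box p B psi ->
  (forall th, in_box p psi th -> nll d X n (net d K M th) Y <= c) ->
  fine (ELBOobj d X n K M B Y psi) <= c + klr psi.
Proof.
move=> h hc; have hp := valid_box_proper _ _ _ h.
rewrite ELBOobjE//; have [e he e0] := Ebox_nll_fin Y psi h.
rewrite he /= lerD2r -lee_fin -he.
have c0 : 0 <= c.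
  (* The sign of [c] follows by evaluating at the lower corner of the box. *)
  apply: le_trans (hc (fun j => psi.1 j) _); first exact: nll_ge0.
  by move=> j jp; rewrite /box /= in_itv /= lexx /= ltW// hp.
rewrite -(Ebox_cst p psi hp _ c0); apply: Ebox_mono => // th; rewrite ?lee_fin ?nll_ge0//.
Qed.

End Elbo.

(** * The finite-sample bound *)

Section FixedSample.
Context {R : realType} (d : nat) (X : nat -> nat -> 'rV[R]_d) (n : nat).
Hypothesis hX : forall i, (i < n)%N -> cube d (X n i).
Variables (f : 'rV[R]_d -> R) (B : R).
Hypotheses (hB : 1 <= B) (hn : (0 < n)%N).

Definition gap (K M : nat) (th : nat -> R) (i : nat) : R :=
  net d K M th (X n i) - f (X n i).

Definition inner (Y v : nat -> R) : R := \sum_(i < n) v i * (Y i - f (X n i)).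
Definition sqn (v : nat -> R) : R := \sum_(i < n) v i ^+ 2.
Definition noise1 (Y : nat -> R) : R := \sum_(i < n) `|Y i - f (X n i)|.

Lemma nll_gap K M th Y : nll d X n (net d K M th) Y =
  nll d X n f Y - inner Y (gap K M th) + 2^-1 * sqn (gap K M th).
Proof. exact: nll_shift. Qed.

Lemma lik_gap K M th Y : lik d X n (net d K M th) Y =
  lik d X n f Y * tilt d X n (- (2^-1 * sqn (gap K M th))) (gap K M th) f Y.
Proof.
by rewrite !likE nll_gap /tilt -expRD; congr expR; rewrite /inner; ring.
Qed.

(** Tolerance for moving within a cell: when the [l^1] norm of the noise is at most [n^2], changing
    each entry of [g] by [1 / n^2] changes [<Z,g>] by at most 1. *)
Let ep : R := (n%:R ^+ 2)^-1.

Let ep0 : 0 <= ep. Proof. by rewrite invr_ge0 exprn_ge0. Qed.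

Let n_gt0 : 0 < n%:R :> R. Proof. by rewrite ltr0n. Qed.

Let nep : n%:R * ep ^+ 2 <= 1.
Proof.
have n1 : 1 <= n%:R :> R by rewrite ler1n.
rewrite /ep exprVn mulrC ler_pdivrMl ?exprn_gt0// mulr1 -exprM.
by rewrite -[leLHS]expr1 ler_weXn2l.
Qed.

Section Model.
Variables (K M : nat) (del : R).
Let p := npar d K M.
Hypotheses (hK : (2 <= K)%N) (hdel : 0 < del) (hdelB : del <= B)
  (hlip : del * K%:R * ((M.+1 * d.+1)%:R * B) ^+ K <= ep).

Lemma gap_close th th0 : bounded_par d K M B th0 -> bounded_par d K M B th ->
  (forall j, (j < p)%N -> `|th j - th0 j| <= del) ->
  forall i, (i < n)%N -> `|gap K M th i - gap K M th0 i| <= ep.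
Proof.
move=> h0 h hd i i_n; rewrite /gap opprB addrA subrK.
by apply: le_trans hlip; apply: net_lip => //; [exact: hX|exact: ltW].
Qed.

Lemma inner_close v w Y : (forall i, (i < n)%N -> `|v i - w i| <= ep) ->
  noise1 Y <= n%:R ^+ 2 -> `|inner Y v - inner Y w| <= 1.
Proof.
move=> hvw hY; rewrite /inner -sumrB; apply: (le_trans (ler_norm_sum _ _ _)).
have -> : 1 = ep * n%:R ^+ 2 by rewrite /ep mulVf// expf_neq0// gt_eqF.
apply: (@le_trans _ _ (ep * noise1 Y)); last exact: ler_wpM2l.
rewrite /noise1 mulr_sumr; apply: ler_sum => i _.
by rewrite -mulrBl normrM ler_wpM2r// hvw.
Qed.

Lemma sqn_close v w : (forall i, (i < n)%N -> `|v i - w i| <= ep) ->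
  sqn v <= 2 * sqn w + 2.
Proof.
move=> hvw; apply: (@le_trans _ _ (2 * sqn w + 2 * (n%:R * ep ^+ 2))); last first.
  by rewrite lerD2l ler_piMr.
have -> : n%:R * ep ^+ 2 = \sum_(i < n) ep ^+ 2 by rewrite sumr_const card_ord mulr_natl.
rewrite /sqn !mulr_sumr -big_split /=; apply: ler_sum => i _.
have : (v i - w i) ^+ 2 <= ep ^+ 2.
  by rewrite -[leLHS]real_normK ?num_real// lerXn2r ?nnegrE// hvw.
(* This square is the difference of the two sides in [v^2 <= 2 w^2 + 2 (v - w)^2]. *)
have := sqr_ge0 (2 * w i - v i); nra.
Qed.

(* Averaging over a cell of side [del] replaces a covering argument: the supremum over the
   parameter cube is controlled by the prior integral, at the price of the volume ratio. *)
Lemma sup_gap_bound Y u th0 : bounded_par d K M B th0 -> noise1 Y <= n%:R ^+ 2 ->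
  ((expR (klr d K M B (near_box B del th0)))%:E * Ebox p (prior_box B) (fun th =>
     (tilt d X n (- (32^-1 * sqn (gap K M th))) (fun i => 4^-1 * gap K M th i) f Y)%:E)
   <= (expR u)%:E)%E ->
  inner Y (gap K M th0) - 4^-1 * sqn (gap K M th0) <= 4 * u + 2.
Proof.
move=> h0 hY hu; set nb := near_box B del th0 in hu.
have hnb : valid_box p B nb by exact: near_box_valid.
have hp := valid_box_proper _ _ _ hnb.
set s0 := (X in X <= _); pose G th : R :=
  tilt d X n (- (32^-1 * sqn (gap K M th))) (fun i => 4^-1 * gap K M th i) f Y.
have mgap d' (T' : measurableType d') (w : T' -> nat -> R) : meas_coord w ->
    meas_coord (fun t => gap K M (w t)).
  by move=> mw j; apply: measurable_funB => //; exact: measurable_net.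
have mG : cmeas (fun th => (G th)%:E).
  apply/cmeasP => d' T' w mw; apply/measurable_EFinP; apply: measurable_tilt.
  - apply: measurableT_comp => //; apply: measurable_funM => //.
    by apply: measurable_sum => i; apply: measurable_funX; exact: (mgap _ _ _ mw).
  - by move=> j; apply: measurable_funM => //; exact: (mgap _ _ _ mw).
  - by move=> j; exact: measurable_cst.
(* On the cell the square at most doubles, up to 2, and the inner product drops by at most 1. The
   exponent is therefore at least [inner / 4 - sqn / 16 - 5 / 16], evaluated at the centre, hence at
   least [(s0 - 2) / 4]. *)
have : ((expR (4^-1 * (s0 - 2)))%:E <= (expR u)%:E)%E.
  apply: le_trans hu; rewrite expR_klr//.
  apply: le_trans (Ebox_le_prior p nb B (fun th => (G th)%:E) hnb _ mG _); last 2 first.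
  - exact: lt_le_trans ltr01 hB.
  - by move=> th; rewrite lee_fin tilt_ge0.
  rewrite -(Ebox_cst p nb hp _ (expR_ge0 _)).
  apply: Ebox_mono => // th hth; rewrite lee_fin ler_expR.
  have hb : bounded_par d K M B th by move=> j jp; exact: valid_box_bounded hth j jp.
  have hc : forall i, (i < n)%N -> `|gap K M th i - gap K M th0 i| <= ep.
    by apply: gap_close => //; apply: (near_box_dist _ _ _ _ hdel hdelB h0 _ hth).
  have := inner_close _ _ Y hc hY; have := sqn_close _ _ hc.
  have -> : \sum_(i < n) 4^-1 * gap K M th i * (Y i - f (X n i)) =
      4^-1 * inner Y (gap K M th).
    by rewrite /inner mulr_sumr; apply: eq_bigr => i _; rewrite mulrA.
  rewrite /s0 ler_norml => h1 /andP[h2 _]; lra.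
rewrite lee_fin ler_expR; lra.
Qed.

Lemma near_energy Y th0 (r a : R) :
  bounded_par d K M B th0 -> noise1 Y <= n%:R ^+ 2 ->
  (forall i, (i < n)%N -> `|gap K M th0 i| <= r) -> - a <= inner Y (gap K M th0) ->
  fine (ELBOobj d X n K M B Y (near_box B del th0)) <=
    nll d X n f Y + a + 1 + (n%:R * r ^+ 2 + 1) + klr d K M B (near_box B del th0).
Proof.
move=> h0 hY hr ha; have hnb : valid_box p B (near_box B del th0) by exact: near_box_valid.
apply: energy_upper => // th hth.
have hb : bounded_par d K M B th by move=> j jp; exact: valid_box_bounded hth j jp.
have hc : forall i, (i < n)%N -> `|gap K M th i - gap K M th0 i| <= ep.
  by apply: gap_close => //; apply: (near_box_dist _ _ _ _ hdel hdelB h0 _ hth).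
have := inner_close _ _ Y hc hY; have := sqn_close _ _ hc.
have : sqn (gap K M th0) <= n%:R * r ^+ 2.
  have -> : n%:R * r ^+ 2 = \sum_(i < n) r ^+ 2 by rewrite sumr_const card_ord mulr_natl.
  apply: ler_sum => i _; rewrite -[leLHS]real_normK ?num_real// lerXn2r ?nnegrE ?hr//.
  exact: le_trans (hr i (ltn_ord i)).
by rewrite nll_gap ler_norml => h1 h2 /andP[h3 _]; lra.
Qed.

Lemma klr_near th0 : bounded_par d K M B th0 ->
  klr d K M B (near_box B del th0) = p%:R * ln ((B *+ 2) / del).
Proof.
move=> h0; rewrite /klr near_box_vol invrK -exprVn -exprMn mulrC.
rewrite lnXn ?mulr_natl// divr_gt0// mulrn_wgt0//; exact: lt_le_trans ltr01 hB.
Qed.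

End Model.
End FixedSample.

(** * Averages over architectures and over the prior *)

Section Mixture.
Context {R : realType}.

(** Here [W0] is a lower bound for the normalising sum: a term is harmless if its mass is at most
    [eta] or if its weight is small compared with [W0]. *)
Lemma mixture_bound (I : eqType) (s : seq I) (w xi t : I -> R) (eta W0 e : R) :
  0 < W0 -> W0 <= \sum_(i <- s) w i -> 0 <= e -> (forall i, i \in s -> 0 <= t i) ->
  (forall i, i \in s -> w i * xi i <= eta * w i + W0 * (e + t i)) ->
  (\sum_(i <- s) w i * xi i) / \sum_(i <- s) w i <= eta + (size s)%:R * e + \sum_(i <- s) t i.
Proof.
move=> W00 hW e0 t0 h; have W1 := lt_le_trans W00 hW.
rewrite ler_pdivrMr//.
apply: (@le_trans _ _ (eta * \sum_(i <- s) w i +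
    W0 * ((size s)%:R * e + \sum_(i <- s) t i))).
  have -> : (size s)%:R * e = \sum_(i <- s) e.
    by rewrite big_const_seq count_predT iter_addr_0 mulr_natl.
  rewrite -big_split /= !mulr_sumr -big_split /= big_seq [leRHS]big_seq.
  by apply: ler_sum => i; exact: h.
rewrite -!addrA [leRHS]mulrDl lerD2l mulrC ler_wpM2l// addr_ge0//.
  by rewrite mulr_ge0.
by rewrite big_seq sumr_ge0.
Qed.

Lemma mixture_le1 (I : eqType) (s : seq I) (w xi : I -> R) :
  (forall i, i \in s -> 0 <= w i) -> (forall i, i \in s -> xi i <= 1) ->
  (\sum_(i <- s) w i * xi i) / \sum_(i <- s) w i <= 1.
Proof.
move=> w0 xi1; have W0 : 0 <= \sum_(i <- s) w i by rewrite big_seq sumr_ge0.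
have [->|W1] := eqVneq (\sum_(i <- s) w i) 0; first by rewrite invr0 mulr0.
rewrite ler_pdivrMr ?mul1r; last by rewrite lt_neqAle eq_sym W1.
rewrite big_seq [leRHS]big_seq; apply: ler_sum => i si.
by rewrite ler_piMr ?w0 ?xi1.
Qed.

End Mixture.

Section PriorExpectation.
Context {R : realType} (d : nat) (X : nat -> nat -> 'rV[R]_d) (n : nat) (f : 'rV[R]_d -> R).
Variables (p : nat) (psi : (nat -> R) * (nat -> R)).
Hypothesis hpsi : proper_box p psi.

Lemma cmeas_Ebox (F : (nat -> R) -> (nat -> R) -> \bar R) : jmeas2 F ->
  (forall th Y, 0 <= F th Y)%E -> cmeas (fun Y => Ebox p psi (F^~ Y)).
Proof.
move=> mF F0; apply/cmeasP => d' T' y my; apply: emeasurable_funM; last first.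
  exact: measurable_cst.
apply: (measurable_iint _ _ (fun t th => F th (y t))) => //; first exact: measD_box.
move=> d'' T'' v u mv mu_; apply: mF => // j; exact: (measurableT_comp (my j)).
Qed.

Variables (a : (nat -> R) -> R) (v : (nat -> R) -> nat -> R).
Hypothesis ma : forall d' (T' : measurableType d') (u : T' -> nat -> R), meas_coord u ->
  measurable_fun [set: T'] (fun t => a (u t)).
Hypothesis mv : forall d' (T' : measurableType d') (u : T' -> nat -> R), meas_coord u ->
  meas_coord (fun t => v (u t)).

Lemma cmeas_Ebox_tilt : cmeas (fun Y => Ebox p psi (fun th => (tilt d X n (a th) (v th) f Y)%:E)).
Proof. by apply: cmeas_Ebox => [|th Y]; [exact: jmeas2_tilt|rewrite lee_fin tilt_ge0]. Qed.

(** The hypothesis says that each tilt has expectation 1; Tonelli transfers this to the average over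
    the box. *)
Lemma Egauss_Ebox_tilt : (forall th, a th + 2^-1 * \sum_(i < n) v th i ^+ 2 = 0) ->
  Egauss d X n f (fun Y => Ebox p psi (fun th => (tilt d X n (a th) (v th) f Y)%:E)) = 1%E.
Proof.
move=> hav; have V0 : 0 <= (boxvol p psi)^-1 by rewrite invr_ge0 ltW// boxvol_gt0.
have mF : jmeas2 (fun th Y => (tilt d X n (a th) (v th) f Y)%:E) by exact: jmeas2_tilt.
have F0 th Y : (0 <= (tilt d X n (a th) (v th) f Y)%:E)%E by rewrite lee_fin tilt_ge0.
transitivity (Egauss d X n f (fun Y => ((boxvol p psi)^-1)%:E *
    iint p (box psi) (fun th => (tilt d X n (a th) (v th) f Y)%:E))%E).
  by apply: eq_iint => Y; rewrite /Ebox [in LHS](muleC (iint _ _ _)).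
rewrite EgaussZ//; last 2 first.
- apply/cmeasP => d' T' y my.
  apply: (measurable_iint _ _ (fun t th => (tilt d X n (a th) (v th) f (y t))%:E)) => //.
    exact: measD_box.
  by move=> d'' T'' w u mw mu_; apply: mF => // j; exact: (measurableT_comp (my j)).
- by move=> Y; exact: iint_ge0.
rewrite (Egauss_iint _ _ _ _ p (box psi) _ (measD_box p psi) mF F0).
rewrite muleC -[LHS]/(Ebox p psi _) -(Ebox_cst p psi hpsi 1 ler01).
by congr Ebox; apply/funext => th; rewrite Egauss_tilt hav expR0.
Qed.

End PriorExpectation.

(** * Posterior mass of the bad event at fixed sample size *)

Section FiniteSample.
Context {R : realType} (d : nat) (X : nat -> nat -> 'rV[R]_d) (n : nat).
Hypothesis hX : forall i, (i < n)%N -> cube d (X n i).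
Variables (f : 'rV[R]_d -> R) (Ms : seq (nat * nat)) (B b0 tau : R).
Hypotheses (hB : 1 <= B) (hn : (0 < n)%N) (hb0 : 0 < b0) (htau : 0 < tau).
Hypothesis hMs : forall m : nat * nat, m \in Ms -> (2 <= m.1)%N /\ (1 <= m.2)%N.
Variable psihat : nat * nat -> (nat -> R) -> (nat -> R) * (nat -> R).
Hypothesis hpsi : forall (m : nat * nat) Y, m \in Ms ->
  valid_box (npar d m.1 m.2) B (psihat m Y) /\
  (forall psi, valid_box (npar d m.1 m.2) B psi ->
    (ELBOobj d X n m.1 m.2 B Y (psihat m Y) <= ELBOobj d X n m.1 m.2 B Y psi)%E).

Let al (m : nat * nat) : R := alpha b0 n m.1 m.2.
Let bad (m : nat * nat) := bad_event d X n m.1 m.2 f tau%:E.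
Let energy (m : nat * nat) Y : R := fine (ELBOobj d X n m.1 m.2 B Y (psihat m Y)).
Let mass (m : nat * nat) Y : R :=
  fine (Ebox (npar d m.1 m.2) (psihat m Y) (fun th => (\1_(bad m) th)%:E)).
Let wt (m : nat * nat) Y : R := al m * expR (- energy m Y).
Let gp (m : nat * nat) := gap d X n f m.1 m.2.

Let al_gt0 m : 0 < al m. Proof. exact: expR_gt0. Qed.

Let al_le1 m : al m <= 1.
Proof.
have ln0 : 0 <= ln (n%:R : R) by apply: ln_ge0; rewrite ler1n.
rewrite /al /alpha -[leRHS]expR0 ler_expR !mulNr oppr_le0; apply: mulr_ge0 => //.
by apply: mulr_ge0; [exact: ltW|exact: sqr_ge0].
Qed.

Let n_gt0 : 0 < n%:R :> R. Proof. by rewrite ltr0n. Qed.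

Lemma badP m th : bad m th <-> n%:R * tau ^+ 2 <= sqn n (gp m th).
Proof.
have s0 : 0 <= sqn n (gp m th) by apply: sumr_ge0 => i _; exact: sqr_ge0.
have q0 : 0 <= n%:R^-1 * sqn n (gp m th) by rewrite mulr_ge0// invr_ge0.
rewrite /bad /bad_event /= lee_fin /empnorm -/(sqn n (gp m th)).
rewrite -(@ler_pXn2r _ 2)// ?nnegrE ?sqrtr_ge0 ?(ltW htau)// sqr_sqrtr//.
by rewrite ler_pdivlMl.
Qed.

Let mgap m d' (T' : measurableType d') (u : T' -> nat -> R) : meas_coord u ->
  meas_coord (fun t => gp m (u t)).
Proof. by move=> mu_ j; apply: measurable_funB => //; exact: measurable_net. Qed.

Let msqn m d' (T' : measurableType d') (u : T' -> nat -> R) : meas_coord u ->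
  measurable_fun [set: T'] (fun t => sqn n (gp m (u t))).
Proof.
by move=> mu_; apply: measurable_sum => i; apply: measurable_funX; exact: mgap.
Qed.

Let mbad m : cmeas (fun th => (\1_(bad m) th)%:E).
Proof.
apply/cmeasP => d' T' u mu_; apply/measurable_EFinP.
have -> : (fun t => \1_(bad m) (u t) : R) =
   \1_([set: T'] `&` (fun t => sqn n (gp m (u t))) @^-1` `[n%:R * tau ^+ 2, +oo[%classic).
  apply/funext => t; rewrite !indicE; congr (nat_of_bool _)%:R; apply/idP/idP.
    by rewrite !inE => /badP h; split => //; rewrite /= in_itv /= h.
  by rewrite !inE => -[_ /=]; rewrite in_itv /= andbT => h; apply/badP.
apply: measurable_indic; exact: (msqn m _ _ u mu_).
Qed.

Let ind_mass m Y : m \in Ms ->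
  Ebox (npar d m.1 m.2) (psihat m Y) (fun th => (\1_(bad m) th)%:E) = (mass m Y)%:E /\
  0 <= mass m Y <= 1.
Proof.
move=> mM; have hv := valid_box_proper _ _ _ (proj1 (hpsi m Y mM)).
have i0 th : (0 <= (\1_(bad m) th : R)%:E)%E by rewrite lee_fin indicE ler0n.
have i1 th : ((\1_(bad m) th : R)%:E <= 1%:E)%E by rewrite lee_fin indicE lern1 leq_b1.
have [e he e0] := Ebox_fin _ _ hv _ 1 i0 (fun th _ => i1 th).
have := Ebox_mono _ _ hv _ (fun=> 1%:E) i0 (fun th _ => i1 th).
by rewrite /mass he /= Ebox_cst// lee_fin e0 => ->.
Qed.

(** Finiteness of the objective turns the extended-real mixture into a quotient of real sums. *)
Lemma vpostE Y : vpost d X b0 Ms B n (psihat^~ Y) Y f tau%:E =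
  ((\sum_(m <- Ms) wt m Y * mass m Y) / \sum_(m <- Ms) wt m Y)%:E.
Proof.
have hw m : m \in Ms -> ((alpha b0 n m.1 m.2)%:E *
    expeR (- ELBOobj d X n m.1 m.2 B Y (psihat m Y)))%E = (wt m Y)%:E.
  move=> mM; have [h1 h2] := hMs m mM; have [h3 _] := hpsi m Y mM.
  by rewrite (ELBOobj_fin _ _ _ hX)//.
rewrite /vpost /= big_seq [X in (_ * ((fine X)^-1)%:E)%E]big_seq.
rewrite (eq_bigr (fun m => (wt m Y * mass m Y)%:E)); last first.
  by move=> m mM; rewrite hw// -/(bad m) (proj1 (ind_mass m Y mM)) -EFinM.
rewrite (eq_bigr (fun m => (wt m Y)%:E) (fun m mM => hw m mM)).
by rewrite -!big_seq !sumEFin -EFinM.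
Qed.

Lemma vpost_le1 Y : (vpost d X b0 Ms B n (psihat^~ Y) Y f tau%:E <= 1)%E.
Proof.
rewrite vpostE lee_fin; apply: mixture_le1 => m mM.
  by rewrite mulr_ge0 ?expR_ge0// ltW.
by have [_ /andP[]] := ind_mass m Y mM.
Qed.

Lemma vpost_ge0 Y : (0 <= vpost d X b0 Ms B n (psihat^~ Y) Y f tau%:E)%E.
Proof.
rewrite vpostE lee_fin divr_ge0// big_seq sumr_ge0// => m mM.
  by rewrite !mulr_ge0 ?expR_ge0 ?(ltW (al_gt0 m))//; have [_ /andP[]] := ind_mass m Y mM.
by rewrite mulr_ge0 ?expR_ge0// ltW.
Qed.

(** [ms] and [ths] are the almost optimal architecture and parameter, with [r] bounding the
    approximation error. [k0] and [k1] control cell log-volumes, [a0] and [b] prior weights, [ku]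
    the threshold for small architectures; [eta] is the tolerated mass. *)
Variables (del : nat * nat -> R) (large : pred (nat * nat)) (ms : nat * nat) (ths : nat -> R).
Variables (N r k0 k1 a0 b ku eta : R).
Let kl (m : nat * nat) : R := (npar d m.1 m.2)%:R * ln ((B *+ 2) / del m).
Hypothesis hdel : forall m : nat * nat, m \in Ms -> [/\ 0 < del m, del m <= B &
  del m * m.1%:R * ((m.2.+1 * d.+1)%:R * B) ^+ m.1 <= (n%:R ^+ 2)^-1].
Hypotheses (hms : ms \in Ms) (hths : bounded_par d ms.1 ms.2 B ths) (hN : 1 <= N).
Hypotheses (hr : forall i, (i < n)%N -> `|gp ms ths i| <= r) (hrN : n%:R * r ^+ 2 <= 4 * N).
Hypotheses (hk0 : kl ms <= k0 * N)
  (hk1 : forall m, m \in Ms -> ~~ large m -> kl m <= k1 * N).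
Hypotheses (hals : expR (- (a0 * N)) <= al ms)
  (hlarge : forall m, m \in Ms -> large m -> al m <= expR (- (b * N))).
Hypotheses (hku : 0 <= ku) (heta : 0 <= eta).

(** [c2] is the exponent in the lower bound for the weight of [ms]: its 9 collects 3 from the noise,
    4 from the approximation error and 2 from moving within the cell, using [1 <= N]. [c3] adds the
    fluctuation bound [4 ku N + 2], and [kap] is the loss on the bad event. *)
Let c2 := 9 + k0 + a0.
Let c3 := c2 + 4 * ku + 2.
Let kap := n%:R * tau ^+ 2 / 4.
Let Pi := prior_box B.
Let B0 : 0 < B. Proof. exact: lt_le_trans ltr01 hB. Qed.

Let tiltL m Y th := tilt d X n (- (2^-1 * sqn n (gp m th))) (gp m th) f Y.
Let tiltS m Y th := tilt d X n (- (32^-1 * sqn n (gp m th))) (fun i => 4^-1 * gp m th i) f Y.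

(** [U1], [U2] and [U4] are at least 1 when, respectively, [<Z,g>] is at most [- 3 N] at [ths], a
    prior average for a small architecture is too large, or the noise exceeds [n^2] in [l^1] norm.
    [U3] bounds the weights of the large architectures relative to the guaranteed weight of [ms]. *)
Let U1 Y := (tilt d X n (- (3 * N)) (fun i => - gp ms ths i) f Y)%:E : \bar R.
Let U2 Y := (\sum_(m <- [seq m <- Ms | ~~ large m])
  (expR (- (ku * N) + kl m))%:E * Ebox (npar d m.1 m.2) Pi (fun th => (tiltS m Y th)%:E))%E.
Let U3 Y := (\sum_(m <- [seq m <- Ms | large m])
  (al m * expR (c2 * N))%:E * Ebox (npar d m.1 m.2) Pi (fun th => (tiltL m Y th)%:E))%E.
Let U4 Y := (\sum_(i <- enum 'I_n) ((n%:R ^+ 2)^-1)%:E *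
  ((tilt d X n 0 (fun j => (j == i :> nat)%:R) f Y)%:E +
   (tilt d X n 0 (fun j => - (j == i :> nat)%:R) f Y)%:E))%E.

Let mstar_energy Y : noise1 d X n f Y <= n%:R ^+ 2 -> - (3 * N) <= inner d X n f Y (gp ms ths) ->
  expR (- (nll d X n f Y + c2 * N)) <= wt ms Y.
Proof.
move=> hY hin; have [h1 h2 h3] := hdel ms hms; have [h4 h5] := hMs ms hms.
have hnb : valid_box (npar d ms.1 ms.2) B (near_box B (del ms) ths) by exact: near_box_valid.
(* The fitted box does at least as well as the cell around [ths]. *)
have he : energy ms Y <= nll d X n f Y + (9 + k0) * N.
  have [hv /(_ _ hnb) hopt] := hpsi ms Y hms.
  apply: (@le_trans _ _ (fine (ELBOobj d X n ms.1 ms.2 B Y (near_box B (del ms) ths)))).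
    rewrite /energy -lee_fin -!ELBOobj_fin//.
  apply: (le_trans (near_energy d X n hX f B hB hn ms.1 ms.2 (del ms) h4 h1 h2 h3 Y ths r
     (3 * N) hths hY hr hin)).
  rewrite (klr_near d B hB)//; move: hk0 hrN (hN); rewrite /kl => h6 h7 h8; lra.
apply: (@le_trans _ _ (expR (- (a0 * N)) * expR (- energy ms Y))); last first.
  by apply: ler_wpM2r => //; exact: expR_ge0.
by rewrite -expRD ler_expR /c2; lra.
Qed.

Let small_weight Y m : m \in Ms -> ~~ large m -> noise1 d X n f Y <= n%:R ^+ 2 ->
  ((expR (kl m))%:E * Ebox (npar d m.1 m.2) Pi (fun th => (tiltS m Y th)%:E)
    <= (expR (ku * N))%:E)%E ->
  wt m Y <= expR (- (nll d X n f Y + c2 * N)) * expR (c3 * N - kap * mass m Y).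
Proof.
move=> mM mS hY hU; have [h1 h2 h3] := hdel m mM; have [h4 h5] := hMs m mM.
have [hv _] := hpsi m Y mM.
have kap0 : 0 <= kap by rewrite /kap divr_ge0// mulr_ge0// sqr_ge0.
have kuN : 0 <= ku * N by rewrite mulr_ge0// (le_trans ler01).
(* Of the term [sqn / 2] in the likelihood, one half absorbs the fluctuation of [<Z,g>] and the
   other half, at least [kap] on the bad event, remains as the loss. *)
have : nll d X n f Y + kap * mass m Y <= energy m Y + (4 * (ku * N) + 2).
  apply: (energy_lower d X n hX m.1 m.2 B h4 hB Y (psihat m Y) (bad m) _ (4 * (ku * N) + 2) kap
    hv (mbad m)) => //.
  - exact: nll_ge0.
  - by rewrite addr_ge0// mulr_ge0.
  move=> th hth; rewrite (nll_gap d X n f) -/(gp m th).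
  have := sup_gap_bound d X n hX f B hB hn m.1 m.2 (del m) h4 h1 h2 h3 Y (ku * N) th hth hY.
  rewrite (klr_near d B hB)// -/(kl m) => /(_ hU); rewrite -/(gp m th) => h6.
  have : kap * \1_(bad m) th <= 4^-1 * sqn n (gp m th).
    rewrite indicE; case: (boolP (th \in bad m)) => hb; rewrite /= ?mulr1 ?mulr0.
      by move: hb; rewrite inE => /badP hb; rewrite /kap mulrC ler_wpM2l.
    by rewrite mulr_ge0//; apply: sumr_ge0 => i _; exact: sqr_ge0.
  move: h6; lra.
move=> he; apply: (@le_trans _ _ (1 * expR (- energy m Y))).
  by rewrite ler_wpM2r ?expR_ge0.
rewrite mul1r -expRD ler_expR /c3; move: (hN); lra.
Qed.

Let tiltL_lik Y m th : tiltL m Y th = expR (nll d X n f Y) * lik d X n (net d m.1 m.2 th) Y.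
Proof. by rewrite (lik_gap d X n f) likE mulrA -expRD subrr expR0 mul1r. Qed.

Let tiltL_fin Y m : exists2 e, Ebox (npar d m.1 m.2) Pi (fun th => (tiltL m Y th)%:E) = e%:E & 0 <= e.
Proof.
have hv := prior_box_valid (npar d m.1 m.2) _ B0.
apply: (Ebox_fin _ _ (valid_box_proper _ _ _ hv) _ (expR (nll d X n f Y))).
  by move=> th; rewrite lee_fin tilt_ge0.
move=> th _; rewrite lee_fin tiltL_lik ler_piMr ?expR_ge0//.
by rewrite likE -[leRHS]expR0 ler_expR oppr_le0 nll_ge0.
Qed.

(** The evidence bound relative to the likelihood of [f]; the factor [exp (c2 N)] only renormalises
    by the lower bound for the weight of [ms]. *)
Let large_weight Y m : m \in Ms ->
  wt m Y <= expR (- (nll d X n f Y + c2 * N)) * (al m * expR (c2 * N) *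
    fine (Ebox (npar d m.1 m.2) Pi (fun th => (tiltL m Y th)%:E))).
Proof.
move=> mM; have [h4 h5] := hMs m mM; have [hv _] := hpsi m Y mM.
have := evidence_bound d X n hX m.1 m.2 B h4 hB Y _ hv.
have [e he e0] := tiltL_fin Y m; rewrite he /=.
have -> : Ebox (npar d m.1 m.2) (prior_box B) (fun th => (lik d X n (net d m.1 m.2 th) Y)%:E) =
   ((expR (- nll d X n f Y))%:E * e%:E)%E.
  rewrite -he -EboxZ ?expR_ge0//.
  - congr Ebox; apply/funext => th; rewrite -EFinM tiltL_lik mulrA -expRD addNr expR0.
    by rewrite mul1r.
  - apply/cmeasP => d' T' u mu_; apply/measurable_EFinP; apply: measurable_tilt.
    + by apply: measurableT_comp => //; apply: measurable_funM => //; exact: (msqn m _ _ u).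
    + exact: (mgap m _ _ u).
    + by move=> j; exact: measurable_cst.
  - by move=> th; rewrite lee_fin tilt_ge0.
rewrite -EFinM lee_fin -/(energy m Y) => h; rewrite opprD expRD.
have -> : expR (- nll d X n f Y) * expR (- (c2 * N)) * (al m * expR (c2 * N) * e) =
  al m * (expR (- nll d X n f Y) * e) * (expR (- (c2 * N)) * expR (c2 * N)) by ring.
by rewrite -expRD addNr expR0 mulr1 /wt ler_wpM2l// ltW.
Qed.

Let good_bound Y : noise1 d X n f Y <= n%:R ^+ 2 -> - (3 * N) <= inner d X n f Y (gp ms ths) ->
  (forall m, m \in Ms -> ~~ large m -> ((expR (kl m))%:E *
     Ebox (npar d m.1 m.2) Pi (fun th => (tiltS m Y th)%:E) <= (expR (ku * N))%:E)%E) ->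
  (vpost d X b0 Ms B n (psihat^~ Y) Y f tau%:E <=
   (eta + (size Ms)%:R * expR (c3 * N - kap * eta))%:E + U3 Y)%E.
Proof.
move=> hY hin hU.
pose t m : R := if large m then al m * expR (c2 * N) *
    fine (Ebox (npar d m.1 m.2) Pi (fun th => (tiltL m Y th)%:E)) else 0.
have t0 m : 0 <= t m.
  rewrite /t; case: ifP => // _; have [e -> e0] := tiltL_fin Y m.
  by rewrite !mulr_ge0 ?expR_ge0// ltW.
have -> : U3 Y = (\sum_(m <- Ms) t m)%:E.
  rewrite /U3 big_filter -sumEFin big_mkcond; apply: eq_bigr => m _.
  by rewrite /t; case: ifP => // _; have [e -> _] := tiltL_fin Y m; rewrite -EFinM.
rewrite vpostE -EFinD lee_fin; set W0 := expR (- (nll d X n f Y + c2 * N)).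
have w0 m : 0 <= wt m Y by rewrite mulr_ge0 ?expR_ge0// ltW.
have kap0 : 0 <= kap by rewrite /kap divr_ge0// mulr_ge0// sqr_ge0.
apply: (mixture_bound _ _ _ _ _ eta W0) => //; first exact: expR_gt0.
- apply: (le_trans (mstar_energy Y hY hin)).
  by rewrite (big_rem ms)//= lerDl sumr_ge0.
move=> m mM; have [_ /andP[x0 x1]] := ind_mass m Y mM.
have W00 : 0 <= W0 by exact: expR_ge0.
case: (boolP (large m)) => hl.
  have h1 : wt m Y * mass m Y <= wt m Y by rewrite ler_piMr.
  have h2 := large_weight Y m mM.
  have h3 : t m = al m * expR (c2 * N) *
    fine (Ebox (npar d m.1 m.2) Pi (fun th => (tiltL m Y th)%:E)) by rewrite /t hl.
  rewrite -h3 -/W0 in h2.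
  have h4 : 0 <= eta * wt m Y by rewrite mulr_ge0.
  have h5 : 0 <= W0 * expR (c3 * N - kap * eta) by rewrite mulr_ge0 ?expR_ge0.
  by rewrite mulrDr; lra.
have h2 := small_weight Y m mM hl hY (hU m mM hl).
rewrite /t (negbTE hl) addr0.
(* Either the fitted box puts mass at most [eta] on the bad event, or its weight carries the loss
   [exp (- kap eta)]. *)
have [h|h] := leP (mass m Y) eta.
  apply: (@le_trans _ _ (eta * wt m Y)); first by rewrite mulrC ler_wpM2r.
  by rewrite lerDl mulr_ge0// expR_ge0.
apply: (@le_trans _ _ (wt m Y)); first by rewrite ler_piMr.
apply: (le_trans h2); rewrite -/W0.
apply: (@le_trans _ _ (W0 * expR (c3 * N - kap * eta))).
  rewrite ler_wpM2l// ler_expR lerD2l lerN2 ler_wpM2l//; exact: ltW.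
by rewrite lerDr mulr_ge0.
Qed.

Let U1_ge0 Y : (0 <= U1 Y)%E. Proof. by rewrite lee_fin tilt_ge0. Qed.

Let Eb_ge0 m (F : (nat -> R) -> R) : (forall th, 0 <= F th) ->
  (0 <= Ebox (npar d m.1 m.2) Pi (fun th => (F th)%:E))%E.
Proof.
move=> F0; apply: Ebox_ge0; last by move=> th; rewrite lee_fin.
exact: valid_box_proper (prior_box_valid _ _ B0).
Qed.

Let U2_term_ge0 Y m : (0 <= (expR (- (ku * N) + kl m))%:E *
   Ebox (npar d m.1 m.2) Pi (fun th => (tiltS m Y th)%:E))%E.
Proof. by rewrite mule_ge0 ?lee_fin ?expR_ge0//; apply: Eb_ge0 => th; exact: tilt_ge0. Qed.

Let U2_ge0 Y : (0 <= U2 Y)%E.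
Proof. by apply: sume_ge0 => m _; exact: U2_term_ge0. Qed.

Let U3_term_ge0 Y m : (0 <= (al m * expR (c2 * N))%:E *
   Ebox (npar d m.1 m.2) Pi (fun th => (tiltL m Y th)%:E))%E.
Proof.
rewrite mule_ge0 ?lee_fin ?mulr_ge0 ?expR_ge0 ?(ltW (al_gt0 m))//.
by apply: Eb_ge0 => th; exact: tilt_ge0.
Qed.

Let U3_ge0 Y : (0 <= U3 Y)%E.
Proof. by apply: sume_ge0 => m _; exact: U3_term_ge0. Qed.

Let U4_ge0 Y : (0 <= U4 Y)%E.
Proof.
by apply: sume_ge0 => i _; rewrite -EFinD -EFinM lee_fin mulr_ge0 ?addr_ge0 ?tilt_ge0.
Qed.

Let U4_noise Y : ~~ (1 <= U4 Y)%E -> noise1 d X n f Y <= n%:R ^+ 2.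
Proof.
(* Unit vectors as tilt directions extract a single noise coordinate. *)
have hs (i : 'I_n) (s : R) :
    \sum_(j < n) s * (j == i :> nat)%:R * (Y j - f (X n j)) = s * (Y i - f (X n i)).
  rewrite (bigD1 i)//= eqxx mulr1 big1 ?addr0// => j /negbTE ji.
  by rewrite -[_ == _ :> nat]/(j == i) ji mulr0 mul0r.
rewrite -ltNge /U4.
have -> : (\sum_(i <- enum 'I_n) ((n%:R ^+ 2)^-1)%:E *
  ((tilt d X n 0 (fun j => (j == i :> nat)%:R) f Y)%:E +
   (tilt d X n 0 (fun j => - (j == i :> nat)%:R) f Y)%:E))%E =
   ((n%:R ^+ 2)^-1 * \sum_(i < n) (expR (Y i - f (X n i)) + expR (- (Y i - f (X n i)))))%:E.
  rewrite mulr_sumr -sumEFin big_enum /=; apply: eq_bigr => i _.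
  rewrite -EFinD -EFinM /tilt !add0r; congr (_ * (expR _ + expR _))%:E.
    by rewrite -[RHS]mul1r -hs; apply: eq_bigr => j _; rewrite mul1r.
  by rewrite -mulN1r -hs; apply: eq_bigr => j _; rewrite mulN1r.
rewrite lte_fin ltr_pdivrMl ?exprn_gt0// mulr1 => /ltW; apply: le_trans.
apply: ler_sum => i _; set z := Y i - _.
have h1 : z <= expR z by apply: le_trans (expR_ge1Dx z); lra.
have h2 : - z <= expR (- z) by apply: le_trans (expR_ge1Dx (- z)); lra.
have := expR_ge0 z; have := expR_ge0 (- z).
by rewrite ler_norml => h3 h4; apply/andP; split; lra.
Qed.

(** The posterior mass is at most 1, so nothing remains to be shown where one of [U1], [U2], [U4] is
    at least 1. *)
Let vpost_le_U Y : (vpost d X b0 Ms B n (psihat^~ Y) Y f tau%:E <=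
   (eta + (size Ms)%:R * expR (c3 * N - kap * eta))%:E + (U1 Y + (U2 Y + (U3 Y + U4 Y))))%E.
Proof.
set cst := eta + _; have cst0 : (0 <= cst%:E)%E.
  by rewrite lee_fin addr_ge0// mulr_ge0// expR_ge0.
have h1 := vpost_le1 Y.
have [g4|g4] := boolP (1 <= U4 Y)%E.
  by apply: (le_trans h1); apply: (le_trans g4); rewrite !addeA leeDr// !adde_ge0.
have [g1|g1] := boolP (1 <= U1 Y)%E.
  apply: (le_trans h1); apply: (le_trans g1).
  by rewrite (addeCA cst%:E) leeDl// !adde_ge0.
have [g2|g2] := boolP (1 <= U2 Y)%E.
  apply: (le_trans h1); apply: (le_trans g2).
  by rewrite (addeCA (U1 Y)) (addeCA cst%:E) leeDl// !adde_ge0.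
apply: (@le_trans _ _ (cst%:E + U3 Y)%E); last first.
  by rewrite leeD2l// (addeCA (U2 Y)) (addeCA (U1 Y)) leeDl// !adde_ge0.
apply: good_bound; first exact: U4_noise.
  move: g1; rewrite -ltNge lte_fin /tilt -[ltRHS]expR0 ltr_expR.
  have -> : \sum_(i < n) - gp ms ths i * (Y i - f (X n i)) =
     - inner d X n f Y (gp ms ths).
    by rewrite /inner -sumrN; apply: eq_bigr => i _; rewrite mulNr.
  by move=> h; lra.
move=> m mM mS.
have hm : ((expR (- (ku * N) + kl m))%:E *
   Ebox (npar d m.1 m.2) Pi (fun th => (tiltS m Y th)%:E) <= 1)%E.
  move: g2; rewrite -ltNge => /ltW; apply: le_trans.
  rewrite /U2 (big_rem m) /=; last by rewrite mem_filter mS.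
  by rewrite leeDl// sume_ge0.
rewrite -(@lee_pmul2l _ (expR (- (ku * N)))%:E) ?lte_fin ?expR_gt0//.
by rewrite muleA -EFinM -expRD -EFinM -expRD addNr expR0.
Qed.

(** After the [eta] and weight-loss terms come the expectations of [U1] to [U4], in this order. The
    majorants are measurable, so their expectations add up. *)
Lemma finite_sample_bound :
  (Egauss d X n f (fun Y => vpost d X b0 Ms B n (psihat^~ Y) Y f tau%:E) <=
   (eta + (size Ms)%:R * expR (c3 * N - kap * eta) + expR (- N)
    + (size Ms)%:R * expR ((k1 - ku) * N) + (size Ms)%:R * expR ((c2 - b) * N)
    + 4 / n%:R)%:E)%E.
Proof.
have mtilt (a : R) v : cmeas (fun Y => (tilt d X n a v f Y)%:E).
  apply/cmeasP => d' T' u mu_; apply/measurable_EFinP; exact: (measurable_tilt d X n (fun=> a) (fun=> v) u).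
have pp m : proper_box (npar d m.1 m.2) Pi := valid_box_proper _ _ _ (prior_box_valid _ _ B0).
have maS m c : forall d' (T' : measurableType d') (u : T' -> nat -> R), meas_coord u ->
    measurable_fun [set: T'] (fun t => - (c * sqn n (gp m (u t)))).
  move=> d' T' u mu_; apply: measurableT_comp => //; apply: measurable_funM => //.
  exact: msqn.
have mvS m c : forall d' (T' : measurableType d') (u : T' -> nat -> R), meas_coord u ->
    meas_coord (fun t i => c * gp m (u t) i).
  by move=> d' T' u mu_ j; apply: measurable_funM => //; exact: (mgap m _ _ u).
have m1 : cmeas U1 by exact: mtilt.
have mS m : cmeas (fun Y => Ebox (npar d m.1 m.2) Pi (fun th => (tiltS m Y th)%:E)).
  by apply: (cmeas_Ebox_tilt d X n f _ _ _ _ (maS m _) (mvS m _)).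
have mL m : cmeas (fun Y => Ebox (npar d m.1 m.2) Pi (fun th => (tiltL m Y th)%:E)).
  by apply: (cmeas_Ebox_tilt d X n f _ _ _ _ (maS m _) (mgap m)).
have mZ c (G : (nat -> R) -> \bar R) : cmeas G -> cmeas (fun Y => c%:E * G Y)%E.
  move=> mG; apply/cmeasP => d' T' u mu_; apply: emeasurable_funM.
    exact: measurable_cst.
  exact: (proj1 (cmeasP _) mG).
have mDD (F G : (nat -> R) -> \bar R) : cmeas F -> cmeas G -> cmeas (fun Y => F Y + G Y)%E.
  move=> mF mG; apply/cmeasP => d' T' u mu_; apply: emeasurable_funD.
    exact: (proj1 (cmeasP _) mF).
  exact: (proj1 (cmeasP _) mG).
have mSum (I : Type) (s : seq I) (F : I -> (nat -> R) -> \bar R) : (forall i, cmeas (F i)) ->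
    cmeas (fun Y => \sum_(i <- s) F i Y)%E.
  move=> mF; apply/cmeasP => d' T' u mu_.
  by apply: (emeasurable_sum s (h := fun i t => F i (u t))) => i; exact: (proj1 (cmeasP _) (mF i)).
have m2 : cmeas U2 by apply: mSum => m; exact: mZ.
have m3 : cmeas U3 by apply: mSum => m; exact: mZ.
have m4 : cmeas U4 by apply: mSum => i; apply: mZ; exact: mDD.
have cst0 : 0 <= eta + (size Ms)%:R * expR (c3 * N - kap * eta).
  by rewrite addr_ge0// mulr_ge0// expR_ge0.
have mc (c : R) : cmeas (fun _ : nat -> R => c%:E : \bar R).
  by apply/cmeasP => *; exact: measurable_cst.
apply: (le_trans (Egauss_mono d X n f _ _ vpost_ge0 vpost_le_U)).
have m34 := mDD _ _ m3 m4; have m234 := mDD _ _ m2 m34; have m14 := mDD _ _ m1 m234.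
have g34 Y : (0 <= U3 Y + U4 Y)%E by exact: adde_ge0.
have g24 Y : (0 <= U2 Y + (U3 Y + U4 Y))%E by exact: adde_ge0.
have g14 Y : (0 <= U1 Y + (U2 Y + (U3 Y + U4 Y)))%E by exact: adde_ge0.
rewrite (EgaussD _ _ _ _ _ _ (mc _) m14)// (EgaussD _ _ _ _ _ _ m1 m234)//.
rewrite (EgaussD _ _ _ _ _ _ m2 m34)// (EgaussD _ _ _ _ _ _ m3 m4)//.
rewrite Egauss_cst//.
(* The exponent is [- 3 N] plus half the squared norm, which is at most [4 N]. *)
have e1 : (Egauss d X n f U1 <= (expR (- N))%:E)%E.
  rewrite /U1 Egauss_tilt lee_fin ler_expR.
  have : \sum_(i < n) (- gp ms ths i) ^+ 2 <= n%:R * r ^+ 2.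
    have -> : n%:R * r ^+ 2 = \sum_(i < n) r ^+ 2 by rewrite sumr_const card_ord mulr_natl.
    apply: ler_sum => i _; rewrite sqrrN -[leLHS]real_normK ?num_real//.
    by rewrite lerXn2r ?nnegrE ?hr// (le_trans _ (hr i (ltn_ord i))).
  by move: hrN; lra.
have sum_cst (s : seq (nat * nat)) (c : R) : (size s <= size Ms)%N -> 0 <= c ->
    (\sum_(m <- s) c%:E <= ((size Ms)%:R * c)%:E)%E.
  move=> hs c0'; rewrite sumEFin lee_fin big_const_seq count_predT iter_addr_0.
  by rewrite -[leLHS]mulr_natl ler_wpM2r// ler_nat.
have sizef (P : pred (nat * nat)) : (size [seq m <- Ms | P m] <= size Ms)%N.
  by rewrite size_filter count_size.
have e2 : (Egauss d X n f U2 <= ((size Ms)%:R * expR ((k1 - ku) * N))%:E)%E.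
  rewrite /U2 Egauss_sum//; last by move=> m; exact: mZ.
  apply: (le_trans _ (sum_cst _ _ (sizef (fun m => ~~ large m)) (expR_ge0 _))).
  rewrite big_seq [leRHS]big_seq; apply: lee_sum => m.
  rewrite mem_filter => /andP[mlarge mM].
  rewrite EgaussZ ?expR_ge0//; last by move=> Y; apply: Eb_ge0 => th; exact: tilt_ge0.
  rewrite (Egauss_Ebox_tilt d X n f _ _ (pp m) _ _ (maS m _) (mvS m _)).
    by rewrite mule1 lee_fin ler_expR; have := hk1 m mM mlarge; lra.
  (* For the direction [g / 4], half the squared norm is [sqn / 32], which cancels the constant of
     the tilt. *)
  move=> th; under eq_bigr do rewrite exprMn.
  by rewrite -mulr_sumr /sqn; field.
have e3 : (Egauss d X n f U3 <= ((size Ms)%:R * expR ((c2 - b) * N))%:E)%E.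
  rewrite /U3 Egauss_sum//; last by move=> m; exact: mZ.
  apply: (le_trans _ (sum_cst _ _ (sizef large) (expR_ge0 _))).
  rewrite big_seq [leRHS]big_seq; apply: lee_sum => m.
  rewrite mem_filter => /andP[mlarge mM].
  rewrite EgaussZ ?mulr_ge0 ?expR_ge0 ?(ltW (al_gt0 m))//; last first.
    by move=> Y; apply: Eb_ge0 => th; exact: tilt_ge0.
  rewrite (Egauss_Ebox_tilt d X n f _ _ (pp m) _ _ (maS m _) (mgap m)).
    rewrite mule1 lee_fin mulrBl expRD mulrC ler_wpM2l ?expR_ge0//; exact: hlarge.
  by move=> th; rewrite /sqn addNr.
have tl0 (a : R) v Y : (0 <= (tilt d X n a v f Y)%:E)%E by rewrite lee_fin tilt_ge0.
have e4 : (Egauss d X n f U4 <= (4 / n%:R)%:E)%E.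
  rewrite /U4 Egauss_sum; [|by move=> i; apply: mZ; exact: mDD|]; last first.
    by move=> i Y; rewrite -EFinD -EFinM lee_fin mulr_ge0 ?addr_ge0 ?tilt_ge0.
  apply: (@le_trans _ _ (\sum_(i <- enum 'I_n) ((n%:R ^+ 2)^-1 * 4)%:E)%E).
    apply: lee_sum => i _; rewrite EgaussZ//; last 2 first.
    - exact: mDD.
    - by move=> Y; rewrite -EFinD lee_fin addr_ge0 ?tilt_ge0.
    rewrite EgaussD// !Egauss_tilt -EFinD -EFinM lee_fin ler_wpM2l//.
    have hs (s : R) : s ^+ 2 = 1 -> \sum_(j < n) (s * (j == i :> nat)%:R) ^+ 2 = 1.
      move=> s1; rewrite (bigD1 i)//= eqxx mulr1 s1 big1 ?addr0// => j /negbTE ji.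
      by rewrite -[_ == _ :> nat]/(j == i) ji mulr0 expr0n.
    have -> : \sum_(j < n) (j == i :> nat)%:R ^+ 2 = 1 :> R.
      by rewrite -[RHS](hs 1 (expr1n _ _)); apply: eq_bigr => j _; rewrite mul1r.
    have hs1 := hs (- 1) (etrans (sqrrN 1) (expr1n _ _)).
    have -> : \sum_(j < n) (- (j == i :> nat)%:R) ^+ 2 = 1 :> R.
      by rewrite -[RHS]hs1; apply: eq_bigr => j _; rewrite mulN1r.
    (* [exp (1/2) <= 2] because [exp (- 1/2) >= 1/2]; the [n] summands, each at most [4 / n^2], then
       give [4 / n]. *)
    have : expR (0 + 2^-1 * 1) <= 2 :> R.
      rewrite add0r mulr1 -[X in expR X]opprK expRN invf_ple ?posrE ?expR_gt0//.
      by apply: le_trans (expR_ge1Dx _); lra.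
    lra.
  rewrite big_enum /= sumEFin lee_fin sumr_const card_ord -mulr_natl.
  by rewrite le_eqVlt; apply/orP; left; apply/eqP; field; rewrite gt_eqF.
set s1 := expR (- N) in e1 *; set s2 := _ * _ in e2 *; set s3 := _ * _ in e3 *.
set s4 := 4 / _ in e4 *; rewrite -[_ + s1 + s2 + s3 + s4]addrA -[_ + s2 + _]addrA.
rewrite -[_ + s1 + _]addrA !EFinD.
by apply: leeD => //; apply: leeD => //; apply: leeD => //; apply: leeD.
Qed.

End FiniteSample.

(** * Rates and asymptotics *)

Section Rate.
Context {R : realType} (d : nat).
Variables (Fs : set ('rV[R]_d -> R)) (fstar : 'rV[R]_d -> R) (Ms : seq (nat * nat)) (B : R).
Variable n : nat.
Hypothesis hf : Fs fstar.
Hypothesis hMs : forall m : nat * nat, m \in Ms -> (2 <= m.1)%N /\ (1 <= m.2)%N.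

Let approx (m : nat * nat) : \bar R := ereal_sup [set ereal_inf
  [set supnorm d (fun x => net d m.1 m.2 theta x - f x)
     | theta in bounded_par d m.1 m.2 B] | f in Fs].

Lemma supnorm_ub (g : 'rV[R]_d -> R) x : cube d x -> (`|g x|%:E <= supnorm d g)%E.
Proof. by move=> hx; apply: ereal_sup_ubound; exists x. Qed.

Let approx_ge0 m : (0 <= approx m)%E.
Proof.
apply: le_ereal_sup_tmp; eexists; first by exists fstar.
apply/ereal_infP => _ [th _ <-].
(* The origin lies in the cube, so the supremum is over a nonempty set. *)
apply: le_trans (supnorm_ub _ 0 _); first by rewrite lee_fin.
by move=> j; rewrite mxE lexx ler01.
Qed.

Lemma rate_ge : (0 < n)%N -> ((Num.sqrt (ln n%:R / n%:R))%:E <= rate d Fs Ms B n)%E.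
Proof.
move=> hn; apply/ereal_infP => _ [m /= mM <-]; have [h1 h2] := hMs m mM.
rewrite -[leLHS]add0e; apply: leeD; first exact: approx_ge0.
by rewrite lee_fin ler_peMl// ler1n muln_gt0 (ltnW h1).
Qed.

(** The infima need not be attained, so a strict upper bound is used to extract witnesses. Both
    parts of the rate are nonnegative, hence each is bounded by [c]. *)
Lemma rate_lt (c : R) : (0 < n)%N -> (rate d Fs Ms B n < c%:E)%E ->
  exists m th, [/\ m \in Ms, bounded_par d m.1 m.2 B th,
    forall x, cube d x -> `|net d m.1 m.2 th x - fstar x| <= c &
    (m.1 * m.2)%:R * Num.sqrt (ln n%:R / n%:R) <= c].
Proof.
move=> hn /ereal_inf_lt [_ [m /= mM <-]] hlt.
set s := (m.1 * m.2)%:R * Num.sqrt _ in hlt *.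
have s0 : 0 <= s by rewrite mulr_ge0.
have h1 : (approx m < c%:E)%E.
  by apply: le_lt_trans hlt; rewrite leeDl// lee_fin.
have h2 : s <= c.
  by rewrite -lee_fin; apply: le_trans (ltW hlt); rewrite leeDr// approx_ge0.
have /ereal_inf_lt [_ [th hth <-] h3] : (ereal_inf
  [set supnorm d (fun x => net d m.1 m.2 theta x - fstar x)%R
     | theta in bounded_par d m.1 m.2 B] < c%:E)%E.
  by apply: le_lt_trans h1; apply: ereal_sup_ubound; exists fstar.
exists m, th; split => // x hx; rewrite -lee_fin.
apply: le_trans (ltW h3).
exact: (supnorm_ub (fun x => net d m.1 m.2 th x - fstar x)).
Qed.

End Rate.

(** * Cell sizes and their logarithmic volume *)

Section Complexity.
Context {R : realType} (d n K M : nat) (B C nu : R).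
Hypotheses (hn : (1 < n)%N) (hK : (2 <= K)%N) (hM : (1 <= M)%N) (hC : 0 < C) (hnu : 0 < nu).
Hypotheses (hB1 : 1 <= B) (hB : B <= C * n%:R `^ nu) (hKM : (maxn K M)%:R <= C * n%:R).
Hypotheses (hn1 : C <= n%:R) (hn2 : 2 * C <= n%:R) (hn3 : 2 * d.+1%:R * C ^+ 2 <= n%:R).

(** The side for which the Lipschitz bound of the network over a cell equals [1 / n^2]. *)
Definition cell : R := (n%:R ^+ 2)^-1 / (K%:R * ((M.+1 * d.+1)%:R * B) ^+ K).

Let Q : R := (M.+1 * d.+1)%:R * B.

Let n1 : 1 <= n%:R :> R. Proof. by rewrite ler1n ltnW. Qed.
Let n0 : 0 < n%:R :> R. Proof. exact: lt_le_trans ltr01 n1. Qed.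
Let Q1 : 1 <= Q.
Proof. by rewrite /Q -[leLHS]mulr1; apply: ler_pM => //; rewrite ler1n. Qed.
Let K0 : 0 < K%:R :> R. Proof. by rewrite ltr0n ltnW. Qed.
Let KQ1 : 1 <= K%:R * Q ^+ K.
Proof.
rewrite -[leLHS]mulr1; apply: ler_pM => //; first by rewrite ler1n ltnW.
exact: exprn_ege1.
Qed.
Let KQ0 : 0 < K%:R * Q ^+ K. Proof. exact: lt_le_trans ltr01 KQ1. Qed.

Lemma cell_gt0 : 0 < cell.
Proof. by rewrite /cell divr_gt0// invr_gt0 exprn_gt0. Qed.

Lemma cell_le : cell <= B.
Proof.
apply: le_trans hB1; rewrite /cell ler_pdivrMr// mul1r.
by apply: le_trans KQ1; rewrite invf_le1 ?exprn_gt0// exprn_ege1.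
Qed.

Lemma cell_lip : cell * K%:R * ((M.+1 * d.+1)%:R * B) ^+ K <= (n%:R ^+ 2)^-1.
Proof. by rewrite -mulrA /cell divfK// gt_eqF. Qed.

Let lnn0 : 0 <= ln (n%:R : R). Proof. exact: ln_ge0. Qed.

Let KCn : K%:R <= C * n%:R :> R.
Proof. by apply: le_trans hKM; rewrite ler_nat leq_maxl. Qed.

Let MCn : M%:R <= C * n%:R :> R.
Proof. by apply: le_trans hKM; rewrite ler_nat leq_maxr. Qed.

Let np0 : 0 < n%:R `^ nu :> R. Proof. exact: powR_gt0. Qed.

(** Polynomial growth in [n] becomes a multiple of [log n]; constants are absorbed into additional
    powers of [n] by the lower bounds on [n]. *)
Let ln_le_pow (x c : R) (k : nat) : 0 < x -> x <= n%:R ^+ k * n%:R `^ c ->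
  ln x <= (k%:R + c) * ln n%:R.
Proof.
move=> x0 hx; have -> : (k%:R + c) * ln (n%:R : R) = ln (n%:R ^+ k * n%:R `^ c).
  rewrite lnM ?posrE ?exprn_gt0 ?powR_gt0// lnXn// ln_powR mulrDl.
  by rewrite mulr_natl.
by rewrite ler_ln ?posrE// mulr_gt0 ?exprn_gt0 ?powR_gt0.
Qed.

Let ln_2B : ln (B *+ 2) <= (1%:R + nu) * ln n%:R.
Proof.
apply: ln_le_pow; first by rewrite mulrn_wgt0// (lt_le_trans ltr01).
rewrite expr1 -[B *+ 2]mulr_natl; apply: (@le_trans _ _ (2 * (C * n%:R `^ nu))).
  by rewrite ler_wpM2l.
by rewrite mulrA ler_wpM2r// ltW.
Qed.

Let ln_K : ln (K%:R : R) <= (2%:R + 0) * ln n%:R.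
Proof.
apply: ln_le_pow => //; rewrite powRr0 mulr1; apply: (le_trans KCn).
by rewrite expr2 ler_wpM2r// ltW.
Qed.

Let ln_Q : ln Q <= (2%:R + nu) * ln n%:R.
Proof.
apply: ln_le_pow; first exact: lt_le_trans ltr01 Q1.
have h1 : M.+1%:R <= 2 * (C * n%:R) :> R.
  have : 1 <= M%:R :> R by rewrite ler1n.
  by rewrite -natr1; move: (MCn); lra.
rewrite /Q natrM.
apply: (@le_trans _ _ ((2 * (C * n%:R)) * d.+1%:R * (C * n%:R `^ nu))).
  by apply: ler_pM => //; [exact: le_trans ler01 hB1|exact: ler_wpM2r].
have -> : 2 * (C * n%:R) * d.+1%:R * (C * n%:R `^ nu) =
   (2 * d.+1%:R * C ^+ 2) * (n%:R * n%:R `^ nu) by ring.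
by rewrite [n%:R ^+ 2]expr2 -[leRHS]mulrA; apply: ler_wpM2r => //; rewrite mulr_ge0// ltW.
Qed.

(** The logarithm splits as [ln (2 B) + 2 ln n + ln K + K ln Q], at most
    [(5 + nu + K (2 + nu)) ln n], hence at most [K (2 nu + 7) ln n]; multiplying by the parameter
    count gives the complexity. *)
Lemma log_volume_bound : (npar d K M)%:R * ln ((B *+ 2) / cell) <=
  (d + 3)%:R * (2 * nu + 7) * ((K * M)%:R ^+ 2 * ln n%:R).
Proof.
have -> : B *+ 2 / cell = B *+ 2 * n%:R ^+ 2 * (K%:R * Q ^+ K).
  rewrite /cell -/Q; have : K%:R * Q ^+ K != 0 by rewrite gt_eqF.
  have : n%:R != 0 :> R by rewrite gt_eqF.
  by move: (K%:R * Q ^+ K) => y hn' hy; field; apply/andP.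
have Q0 : 0 < Q by exact: lt_le_trans ltr01 Q1.
have B20 : 0 < B *+ 2 by rewrite mulrn_wgt0// (lt_le_trans ltr01).
rewrite !lnM ?posrE ?mulr_gt0 ?exprn_gt0// !lnXn//.
have h1 : ln (B *+ 2) + ln n%:R *+ 2 + (ln K%:R + ln Q *+ K) <=
   K%:R * (2 * nu + 7) * ln n%:R.
  have hq : ln Q *+ K <= K%:R * ((2 + nu) * ln n%:R).
    by rewrite -[leLHS]mulr_natl ler_wpM2l.
  have K1 : 1 <= K%:R :> R by rewrite ler1n ltnW.
  have hl : (5 + nu) * ln n%:R <= K%:R * ((5 + nu) * ln n%:R).
    by rewrite ler_peMl// mulr_ge0// addr_ge0// ltW.
  move: (ln_2B) (ln_K); rewrite -[ln n%:R *+ 2]mulr_natl; lra.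
have h2 : 0 <= K%:R * (2 * nu + 7) * ln n%:R.
  by rewrite !mulr_ge0// addr_ge0// mulr_ge0// ltW.
apply: (@le_trans _ _ ((npar d K M)%:R * (K%:R * (2 * nu + 7) * ln n%:R))).
  by rewrite ler_wpM2l.
apply: (@le_trans _ _ (((d + 3) * (K * (M * M)))%:R * (K%:R * (2 * nu + 7) * ln n%:R))).
  by rewrite ler_wpM2r// ler_nat npar_le.
by rewrite !natrM le_eqVlt; apply/orP; left; apply/eqP; ring.
Qed.

End Complexity.

(** Covers an infinite rate: no parameter has infinite empirical error, so the bad event is
    empty. *)
Lemma vpost_infty {R : realType} (d : nat) (X : nat -> nat -> 'rV[R]_d) (b0 : R)
    (Ms : seq (nat * nat)) (B : R) n psihat Y f :
  (forall m : nat * nat, m \in Ms -> valid_box (npar d m.1 m.2) B (psihat m)) ->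
  vpost d X b0 Ms B n psihat Y f +oo = 0%E.
Proof.
move=> h; rewrite /vpost big_seq big1 ?mul0e// => m mM.
have -> : (fun th => (\1_(bad_event d X n m.1 m.2 f +oo) th)%:E) = (fun _ => 0%:E : \bar R).
  by apply/funext => th; rewrite indicE memNset.
by rewrite Ebox_cst ?mule0//; exact: valid_box_proper (h m mM).
Qed.

Theorem theorem4p2 (R : realType) (d : nat) (X : nat -> nat -> 'rV[R]_d)
  (hX : forall n i, (i < n)%N -> cube d (X n i))
  (Fs : set ('rV[R]_d -> R)) (hF : forall f, Fs f -> borel_measurable_cube d f)
  (Ms : nat -> seq (nat * nat)) (B : nat -> R) (b0 : R) (hb0 : 0 < b0)
  (iota nu C : R) (N0 : nat) (hiota : 0 < iota) (hnu : 0 < nu) (hC : 0 < C)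
  (hMsu : forall n, uniq (Ms n))
  (hMs : forall n (KM : nat * nat), KM \in Ms n -> (2 <= KM.1)%N /\ (1 <= KM.2)%N)
  (hcard : forall n, (N0 <= n)%N -> (size (Ms n))%:R <= C * n%:R `^ iota)
  (hmax : forall n (KM : nat * nat), (N0 <= n)%N -> KM \in Ms n -> (maxn KM.1 KM.2)%:R <= C * n%:R)
  (hB1 : forall n, 1 <= B n)
  (hB : forall n, (N0 <= n)%N -> B n <= C * n%:R `^ nu)
  (psihat : nat -> nat * nat -> (nat -> R) -> (nat -> R) * (nat -> R))
  (hpsi : forall n (KM : nat * nat) Y, KM \in Ms n ->
     valid_box (npar d KM.1 KM.2) (B n) (psihat n KM Y) /\
     (forall psi, valid_box (npar d KM.1 KM.2) (B n) psi ->
        (ELBOobj d X n KM.1 KM.2 (B n) Y (psihat n KM Y)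
         <= ELBOobj d X n KM.1 KM.2 (B n) Y psi)%E))
  (A : nat -> R) (hA : A @ \oo --> +oo) :
  forall eps : R, 0 < eps -> exists N : nat, forall n, (N <= n)%N ->
    forall fstar, Fs fstar ->
      (Egauss d X n fstar
         (fun Y => vpost d X b0 (Ms n) (B n) n (fun KM => psihat n KM Y) Y fstar
                     ((A n)%:E * rate d Fs (Ms n) (B n) n))
       <= eps%:E)%E.
Proof.
(* [H] makes the prior weight of large architectures at most [exp (- b N)]. In [b], [ku] and [At],
   the added [iota + 1] pays for the number of architectures and leaves a factor [1 / n]. The last
   term of [nmin] makes the remainders fit into [eps / 2]. *)
move=> eps eps0; pose eta := eps / 2; pose c1 := (d + 3)%:R * (2 * nu + 7).
pose c2 := 9 + 4 * c1 + 4 * b0; pose b := c2 + iota + 1; pose H := b / b0.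
pose k1 := c1 * H; pose ku := k1 + iota + 1; pose c3 := c2 + 4 * ku + 2.
pose At := Num.max 1 (4 * (c3 + iota + 1) / eta).
pose nmin := N0%:R + expR 1 + 2 * C + 2 * d.+1%:R * C ^+ 2 + (6 * C + 10) / eps.
have eta0 : 0 < eta by rewrite divr_gt0.
have c10 : 0 <= c1 by rewrite mulr_ge0// addr_ge0// mulr_ge0// ltW.
have b_gt0 : 0 < b by rewrite /b /c2; lra.
have k10 : 0 <= k1 by rewrite mulr_ge0// divr_ge0// ltW.
(* Fixed before [fstar] is introduced, which gives uniformity over [Fs]. *)
have [N _ hN] : \forall n \near \oo, At <= A n /\ nmin <= n%:R.
  apply: filterI; last exact: nbhs_infty_ger.
  exact: (proj1 (cvgryPge _) hA).
exists N => n /hN [hAn hn] fstar hfstar.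
have e0 : 0 < expR 1 :> R := expR_gt0 1.
have q1 : 0 <= 2 * d.+1%:R * C ^+ 2 :> R by apply: mulr_ge0; [exact: mulr_ge0|exact: sqr_ge0].
have q2 : 0 <= (6 * C + 10) / eps by rewrite divr_ge0 ?ltW// addr_gt0// mulr_gt0.
have q3 : 0 <= N0%:R :> R by [].
have n_N0 : (N0 <= n)%N by rewrite -(ler_nat R); move: hn; rewrite /nmin; lra.
have n_exp : expR 1 <= n%:R :> R by move: hn; rewrite /nmin; lra.
have n_C : C <= n%:R by move: hn; rewrite /nmin; lra.
have n_2C : 2 * C <= n%:R by move: hn; rewrite /nmin; lra.
have n_C2 : 2 * d.+1%:R * C ^+ 2 <= n%:R by move: hn; rewrite /nmin; lra.
have n_eps : (6 * C + 10) / eps <= n%:R by move: hn; rewrite /nmin; lra.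
have n_gt1 : (1 < n)%N.
  by rewrite -(ltr_nat R); have := expR_ge1Dx (1 : R); lra.
have n_gt0 : (0 < n)%N by exact: ltnW.
have nR0 : 0 < n%:R :> R by rewrite ltr0n.
have ln1 : 1 <= ln (n%:R : R).
  by rewrite -[leLHS]expRK ler_ln ?posrE.
have A1 : 1 <= A n by apply: le_trans hAn; rewrite le_max lexx.
have AA : 4 * (c3 + iota + 1) / eta <= A n by apply: le_trans hAn; rewrite le_max lexx orbT.
have A0 : 0 < A n by exact: lt_le_trans A1.
have hrge := rate_ge d Fs fstar (Ms n) (B n) n hfstar (hMs n) n_gt0.
case Erho : (rate d Fs (Ms n) (B n) n) => [rho| |]; last by rewrite Erho in hrge.
  2: { rewrite gt0_muley ?lte_fin//.
  have -> : (fun Y => vpost d X b0 (Ms n) (B n) n (fun KM => psihat n KM Y) Y fstar +oo) =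
      (fun _ => 0%:E).
    by apply/funext => Y; apply: vpost_infty => m mM; exact: (proj1 (hpsi n m Y mM)).
  by rewrite Egauss_cst// lee_fin ltW. }
have sq0 : 0 < ln n%:R / n%:R :> R by rewrite divr_gt0// (lt_le_trans ltr01).
have rho_ge : Num.sqrt (ln n%:R / n%:R) <= rho by rewrite -lee_fin -Erho.
have rho0 : 0 < rho by apply: lt_le_trans rho_ge; rewrite sqrtr_gt0.
(* The factor 2 leaves room for an almost optimal architecture; squared, it is the 4 in [4 * c1] and
   [4 * b0] below. *)
have hlt : (rate d Fs (Ms n) (B n) n < (2 * rho)%:E)%E by rewrite Erho lte_fin; lra.
have [ms [ths [hms hths happ hcost]]] :=
  rate_lt d Fs fstar (Ms n) (B n) n hfstar (2 * rho) n_gt0 hlt.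
pose NN := n%:R * rho ^+ 2.
have sqr_le (x y : R) : 0 <= x -> x <= y -> x ^+ 2 <= y ^+ 2.
  by move=> x0 xy; rewrite lerXn2r ?nnegrE// (le_trans x0).
(* Since [K M >= 1], the rate is at least [sqrt (log n / n)], so exponentials in [- N] beat powers
   of [n]. *)
have NN_ln : ln n%:R <= NN.
  rewrite /NN mulrC -ler_pdivrMr//; apply: le_trans (sqr_le _ _ (sqrtr_ge0 _) rho_ge).
  by rewrite sqr_sqrtr// ltW.
have NN1 : 1 <= NN by exact: le_trans NN_ln.
have hsize m : m \in Ms n -> (m.1 * m.2)%:R * Num.sqrt (ln n%:R / n%:R) <= 2 * rho ->
    (m.1 * m.2)%:R ^+ 2 * ln n%:R <= 4 * NN.
  move=> mM /(sqr_le _ _ (mulr_ge0 (ler0n _ _) (sqrtr_ge0 _))).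
  have -> : (2 * rho) ^+ 2 = 4 * rho ^+ 2 by ring.
  rewrite [leLHS]exprMn sqr_sqrtr; last exact: ltW.
  by rewrite mulrA ler_pdivrMr// /NN; lra.
pose del (m : nat * nat) := cell d n m.1 m.2 (B n) : R.
pose large (m : nat * nat) := H * NN <= (m.1 * m.2)%:R ^+ 2 * ln n%:R.
have hvol m : m \in Ms n ->
    (npar d m.1 m.2)%:R * ln ((B n *+ 2) / del m) <= c1 * ((m.1 * m.2)%:R ^+ 2 * ln n%:R).
  move=> mM; have [h1 h2] := hMs n m mM.
  by apply: (log_volume_bound d n m.1 m.2 (B n) C nu) => //; [exact: hB|exact: hmax].
have hal m : alpha b0 n m.1 m.2 = expR (- (b0 * ((m.1 * m.2)%:R ^+ 2 * ln n%:R))).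
  by rewrite /alpha; congr expR; ring.
have tau0 : 0 < A n * rho by exact: mulr_gt0.
apply: le_trans.
  apply: (finite_sample_bound d X n (hX n) fstar (Ms n) (B n) b0 (A n * rho) (hB1 n) n_gt0
    hb0 tau0 (hMs n) (psihat n) (hpsi n) del large ms ths NN (2 * rho) (4 * c1) k1 (4 * b0)
    b ku eta) => //.
  - move=> m mM; have [h1 h2] := hMs n m mM; split.
    + exact: cell_gt0.
    + exact: cell_le.
    + exact: cell_lip.
  - by move=> i i_n; apply: happ; exact: hX.
  - by rewrite exprMn /NN le_eqVlt; apply/orP; left; apply/eqP; ring.
  - apply: (le_trans (hvol ms hms)); rewrite (mulrC 4) -[leRHS]mulrA.
    by apply: ler_wpM2l => //; exact: hsize.
  - move=> m mM; rewrite /large -ltNge => hsm; apply: (le_trans (hvol m mM)).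
    by rewrite /k1 -[leRHS]mulrA; apply: ler_wpM2l => //; exact: ltW.
  - rewrite hal ler_expR lerN2 (mulrC 4) -[leRHS]mulrA.
    by apply: ler_wpM2l; [exact: ltW|exact: hsize].
  - move=> m mM hl; rewrite hal ler_expR lerN2.
    apply: (@le_trans _ _ (b0 * (H * NN))); last by rewrite ler_wpM2l// ltW.
    by rewrite /H mulrA [b0 * _]mulrC divfK// gt_eqF.
  - by rewrite /ku addr_ge0// addr_ge0// ltW.
  - exact: ltW.
rewrite lee_fin.
have powE : n%:R `^ iota = expR (iota * ln n%:R) by rewrite /powR gt_eqF.
(* The exponent supplies [n^(- iota - 1)] against at most [C n^iota] architectures. *)
have sz (x : R) : x <= - ((iota + 1) * NN) -> (size (Ms n))%:R * expR x <= C / n%:R.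
  move=> hx; apply: (@le_trans _ _ (C * expR (iota * ln n%:R) * expR (- ((iota + 1) * ln n%:R)))).
    apply: ler_pM; rewrite ?expR_ge0//; first by rewrite -powE; exact: hcard.
    rewrite ler_expR; apply: (le_trans hx); rewrite lerN2 ler_wpM2l// addr_ge0//; exact: ltW.
  rewrite -mulrA -expRD ler_wpM2l ?(ltW hC)//.
  have -> : iota * ln n%:R + - ((iota + 1) * ln n%:R) = - ln (n%:R : R) by ring.
  by rewrite expRN lnK.
have b1 : (size (Ms n))%:R * expR ((9 + 4 * c1 + 4 * b0 + 4 * ku + 2) * NN -
    n%:R * (A n * rho) ^+ 2 / 4 * eta) <= C / n%:R.
  apply: sz; have -> : n%:R * (A n * rho) ^+ 2 / 4 * eta = (A n ^+ 2 * eta / 4) * NN.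
    by rewrite /NN exprMn; field.
  (* From [A n >= 1] one has [A n ^+ 2 >= A n], so the linear lower bound in [At] suffices. *)
  have hA2 : c3 + iota + 1 <= A n ^+ 2 * eta / 4.
    rewrite ler_pdivrMr // in AA.
    have : A n * eta <= A n ^+ 2 * eta by rewrite ler_wpM2r ?(ltW eta0)// expr2 ler_peMr// ltW.
    lra.
  have := ler_wpM2r (le_trans ler01 NN1) hA2; rewrite /c3 /c2; lra.
have b2 : (size (Ms n))%:R * expR ((k1 - ku) * NN) <= C / n%:R.
  by apply: sz; rewrite /ku le_eqVlt; apply/orP; left; apply/eqP; ring.
have b3 : (size (Ms n))%:R * expR ((9 + 4 * c1 + 4 * b0 - b) * NN) <= C / n%:R.
  by apply: sz; rewrite /b /c2 le_eqVlt; apply/orP; left; apply/eqP; ring.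
have b4 : expR (- NN) <= 1 / n%:R.
  apply: (@le_trans _ _ (expR (- ln n%:R))); first by rewrite ler_expR lerN2.
  by rewrite expRN lnK// mul1r.
have b5 : 3 * (C / n%:R) + 1 / n%:R + 4 / n%:R <= eps / 2.
  have -> : 3 * (C / n%:R) + 1 / n%:R + 4 / n%:R = (3 * C + 5) / n%:R by field; rewrite gt_eqF.
  rewrite ler_pdivrMr//; move: n_eps; rewrite ler_pdivrMr//; lra.
rewrite /eta; lra.
Qed.
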